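(* Let $T>0$, let $m\ge 1$, let $\alpha_0>\alpha_1>\cdots>\alpha_m\ge 0$ be real numbers, let $n_i$ be the nonnegative integer with $n_i-1<\alpha_i\le n_i$ ($i=0,\dots,m$), and let $\gamma=n_0-\alpha_0$ with $0<\gamma<1$. Consider the equation $${}^cD_{0+}^{\alpha_0}y(t)=-\sum_{i=1}^m a_i(t)\,{}^cD_{0+}^{\alpha_i}y(t),\qquad 0<t<T.\tag{E}$$ Assume that $n_0=n_1$ and that $a_i\in C^1_\gamma[0,T]$ and $D_{0+}^{n_0-\alpha_0}a_i\in C[0,T]$ for $i=1,\dots,m$. With $H_j=\{i\in\{1,\dots,m\}:0\le\alpha_i\le j\}$, assume that $n_0\ge2$ and that there exists $j_0\in\{0,1,\dots,n_0-2\}$ such that $H_{j_0}=\emptyset$ and $H_{j_0+1}\ne\emptyset$; for $j\ge j_0+1$ put $h_j=\min H_j$. Then there exists a unique canonical fundamental system $y_j\in C_\gamma^{n_0}[0,T]$, $j=0,1,\dots,n_0-1$, of solutions of (E), and it is given by $$y_j(t)=\Phi_{j+1}(t),\qquad j=0,1,\dots,j_0,$$ $$y_j(t)=\Phi_{j+1}(t)+\sum_{k=0}^\infty(-1)^{k+1}I_{0+}^{\alpha_0}\Big[\sum_{i=1}^m a_i(t)I_{0+}^{\alpha_0-\alpha_i}\Big]^k\sum_{i=h_j}^m a_i(t)\Phi_{j+1-\alpha_i}(t),\qquad j=j_0+1,\dots,n_0-1.$$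
   Context: All functions are real valued. For $0\le\gamma<1$, $C_\gamma[0,T]$ is the space of functions $f$ on $(0,T]$ such that $t\mapsto t^\gamma f(t)$ belongs to $C[0,T]$ (i.e. extends continuously to $[0,T]$); $C_0[0,T]=C[0,T]$. For $n\in\mathbb N$, $C^n_\gamma[0,T]$ is the space of functions $f$ that are $n-1$ times continuously differentiable on $[0,T]$ and have an $n$-th derivative $f^{(n)}\in C_\gamma[0,T]$; $C^0_\gamma=C_\gamma$. Riemann–Liouville integral: $I_{0+}^\alpha f(t)=\frac1{\Gamma(\alpha)}\int_0^t(t-\tau)^{\alpha-1}f(\tau)\,d\tau$ for $\alpha>0$, and $I^0_{0+}f=f$. Riemann–Liouville derivative: for $n-1<\alpha\le n$, $D_{0+}^\alpha f(t)=\frac{d^n}{dt^n}I_{0+}^{n-\alpha}f(t)$ for $t>0$ (with $D^0_{0+}f=f$). Caputo derivative: for $n-1<\alpha\le n$, ${}^cD_{0+}^\alpha f(t)=D_{0+}^\alpha\big[f(t)-\sum_{k=0}^{n-1}\frac{f^{(k)}(0)}{k!}t^k\big]$; in particular ${}^cD^0_{0+}f=f$. $\Phi_{\beta}(t)=t^{\beta-1}/\Gamma(\beta)$ for $\beta>0$; thus $\Phi_{j+1}(t)=t^j/j!$, and $\Phi_{j+1-\alpha_i}=D_{0+}^{\alpha_i}\Phi_{j+1}$ when $\alpha_i\le j$. The bracket $\big[\sum_i a_i(t)I_{0+}^{\alpha_0-\alpha_i}\big]^k$ is the $k$-th power (composition) of the operator $g\mapsto\sum_{i=1}^m a_i\cdot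 I_{0+}^{\alpha_0-\alpha_i}g$, the $0$-th power being the identity. The infinite series is the limit of its partial sums, for each $t\in[0,T]$. A canonical fundamental system of solutions of (E) is a system of functions $y_0,\dots,y_{n_0-1}$, each satisfying (E), with $D^ky_j(t)|_{t=+0}=1$ if $k=j$ and $=0$ if $k\ne j$, for $k,j=0,1,\dots,n_0-1$, where $D^k=d^k/dt^k$. *)

(* Defs.v *)
(* MathComp-Analysis development over an arbitrary R : realType. *)
From HB Require Import structures.
From mathcomp Require Import all_boot all_order all_algebra.
From mathcomp Require Import all_classical all_reals all_analysis.

Set Implicit Arguments.
Unset Strict Implicit.
Unset Printing Implicit Defensive.

Import Order.TTheory GRing.Theory Num.Theory.
Import numFieldNormedType.Exports.

Local Open Scope classical_set_scope.
Local Open Scope ring_scope.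

(* A function on [0,T] (or on (0,T]) is represented by a total function R -> R
   whose values elsewhere are irrelevant: every notion below depends only on
   the values taken there.  In particular derivatives are taken relative to
   [0,T], i.e. they are one-sided at the endpoints. *)

Section Derivatives.
Context {R : realType}.
Implicit Types (T t : R) (f : R -> R) (n : nat).

Definition diffquot f t (s : R) : R := (f s - f t) / (s - t).

Definition derivable_on T f t : Prop :=
  cvg (diffquot f t @ within `[0, T] t^').

Definition derive_on T f t : R :=
  lim (diffquot f t @ within `[0, T] t^').

Definition deriven_on T n f : R -> R := iter n (derive_on T) f.

(* The successive derivatives of f up to order n exist at t. *)
Definition derivablen_on T n f t : Prop :=
  forall k, (k < n)%N -> derivable_on T (deriven_on T k f) t.

End Derivatives.

Section FunctionSpaces.
Context {R : realType}.
Implicit Types (T gamma : R) (f : R -> R) (n : nat).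

(* C_gamma[0,T]; f is only considered on (0,T], and C_0[0,T] = C[0,T]. *)
Definition Cgamma T gamma f : Prop :=
  exists2 g : R -> R, {within `[0, T], continuous g} &
    forall t, 0 < t <= T -> g t = t `^ gamma * f t.

(* C^n_gamma[0,T]; the n-th derivative is only required on (0,T]. *)
Definition Cngamma T n gamma f : Prop :=
  [/\ forall t, 0 <= t <= T -> derivablen_on T n.-1 f t,
      forall k, (k < n)%N -> {within `[0, T], continuous (deriven_on T k f)},
      forall t, 0 < t <= T -> derivablen_on T n f t
    & Cgamma T gamma (deriven_on T n f)].

End FunctionSpaces.

Section FractionalCalculus.
Context {R : realType}.
Implicit Types (T t alpha beta : R) (f : R -> R).

Definition Gamma (s : R) : R :=
  \int[lebesgue_measure]_(x in `]0, +oo[) (x `^ (s - 1) * expR (- x)).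

Definition Phi beta t : R := t `^ (beta - 1) / Gamma beta.

Definition RLint alpha f t : R :=
  if alpha == 0 then f t
  else (Gamma alpha)^-1 *
       \int[lebesgue_measure]_(tau in `[0, t]) ((t - tau) `^ (alpha - 1) * f tau).

(* For alpha >= 0, the natural number n such that n - 1 < alpha <= n. *)
Definition nceil alpha : nat := `|Num.ceil alpha|%N.

Definition RLderive T alpha f : R -> R :=
  deriven_on T (nceil alpha) (RLint ((nceil alpha)%:R - alpha) f).

Definition RLderivable T alpha f t : Prop :=
  derivablen_on T (nceil alpha) (RLint ((nceil alpha)%:R - alpha) f) t.

Definition taylor_remainder T n f t : R :=
  f t - \sum_(0 <= k < n) deriven_on T k f 0 / k`!%:R * t ^+ k.

Definition caputo T alpha f : R -> R :=
  RLderive T alpha (taylor_remainder T (nceil alpha) f).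

Definition caputo_derivable T alpha f t : Prop :=
  RLderivable T alpha (taylor_remainder T (nceil alpha) f) t.

End FractionalCalculus.

Section Equation.
Context {R : realType}.
Variables (T : R) (m : nat) (alpha : nat -> R) (a : nat -> R -> R).

(* y solves cD^(alpha 0) y = - sum_(i = 1..m) a_i cD^(alpha i) y on (0,T); all the
   Caputo derivatives involved are required to exist there. *)
Definition solution (y : R -> R) : Prop :=
  forall t, 0 < t < T ->
    (forall i, (i <= m)%N -> caputo_derivable T (alpha i) y t) /\
    caputo T (alpha 0%N) y t =
      - \sum_(1 <= i < m.+1) a i t * caputo T (alpha i) y t.

(* The system consists of y 0, ..., y (N - 1); the other y j are irrelevant. *)
Definition canonical_system (N : nat) (y : nat -> R -> R) : Prop :=
  forall j, (j < N)%N ->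
    solution (y j) /\
    forall k, (k < N)%N ->
      deriven_on T k (y j) t @[t --> 0^'+] --> ((k == j)%:R : R).

Definition Hset (j : nat) : set nat :=
  [set i | (1 <= i <= m)%N /\ 0 <= alpha i <= j%:R].

Definition is_min (A : set nat) (h : nat) : Prop :=
  A h /\ forall i, A i -> (h <= i)%N.

Definition Bop (g : R -> R) : R -> R :=
  fun t => \sum_(1 <= i < m.+1) a i t * RLint (alpha 0%N - alpha i) g t.

(* k-th term of the series, h being the first index of the inner sum. *)
Definition series_term (h j k : nat) (t : R) : R :=
  (-1) ^+ k.+1 *
  RLint (alpha 0%N)
    (iter k Bop (fun s =>
       \sum_(h <= i < m.+1) a i s * Phi (j.+1%:R - alpha i) s)) t.

End Equation.

(* Main.v *)
Require Import Defs.
From HB Require Import structures.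
From mathcomp Require Import all_boot all_order all_algebra.
From mathcomp Require Import all_classical all_reals all_analysis.
From mathcomp Require Import measurable_realfun ring lra.
Import Order.TTheory GRing.Theory Num.Theory.
Import numFieldNormedType.Exports.
Local Open Scope classical_set_scope.
Local Open Scope ring_scope.

(* Put b_i = alpha_0 - alpha_i and gam = n_0 - alpha_0.  A function of C^(n_0)_gam
   with the j-th canonical initial data is t^j/j! + I^(n_0) om with om in C_gam,
   and its Caputo derivative of order alpha_i is
   [n_i <= j] Phi_(j+1-alpha_i) + I^(n_0-alpha_i) om.  So (E) becomes the Volterra
   equation x = - f - sum_i a_i I^(b_i) x for x = I^gam om, where f is the inner
   sum of the series.
   Since I^(1-gam) a_i has a continuous derivative g, a_i = I^gam g, whence
   a_i(0) = 0.  The product rule then gives f = I^1 phi with phi in C_gam and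
   sum_i a_i I^(b_i) I^1 v = I^1 (D v), where
   D v = sum_i (a_i' I^(1+b_i) v + a_i I^(b_i) v), and x = - I^1 v reduces the
   Volterra equation to v = phi - D v in C_gam.
   Both D and sum_i a_i I^(b_i) are dominated by a multiple C I^(b_1), so the k-th
   iterate at a function of C_gam is at most M C^k Phi_(1-gam+k b_1), which decays
   faster than any geometric sequence: the Neumann series sum_k (-1)^k D^k phi
   converges to v, and the homogeneous Volterra equation has only the zero
   solution. *)

(** * Kernels, beta and gamma integrals *)

(** Working with v rather than x is what gives the regularity. To have y in C^(n_0)_gam one needs x
    = I^gam om with om in C_gam, and a continuous solution x of the Volterra equation does not by
    itself provide such an om. With x = - I^1 v and v in C_gam, om = - I^(1-gam) v is a density, and
    I^(n_0) om = - I^(alpha_0+1) v; since the k-th iterate of the Volterra operator at f is I^1 (D^k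
    phi), this is the series with I^(alpha_0) in front. Uniqueness is proved for x itself. The
    obstacle is the singularity at 0, where v and a_i' may grow like t^(-gam). Elements of C_gam are
    therefore written t^(-gam) w(t) with w bounded and continuous on the whole line. Rescaling the
    integration variable by t shows that I^b raises the exponent by b and keeps the other factor
    continuous. In D the singular a_i' is paired with I^(1+b_i), a full order more than I^(b_i),
    which pays for t^(-gam) because gam < 1. Likewise a_i(0) = 0 makes a_i of size t^(1-gam), so
    that a_i Phi_del lies in C_gam for every del > 0. *)

Section Affine.
Context {R : realType}.
Notation mu := (@lebesgue_measure R).
Local Open Scope ereal_scope.

Definition affine_fun (a c : R) : measurableTypeR R -> measurableTypeR R :=
  fun x => (a + c * x)%R.

Lemma measurable_affine_fun (a c : R) :
  measurable_fun [set: measurableTypeR R] (affine_fun a c).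
Proof. by apply: measurable_funD => //; exact: measurable_funM. Qed.

Definition affine_measure (a : R) (c : {nonneg R}) :
    {measure set (measurableTypeR R) -> \bar R} :=
  mscale c (measure_function_pushforward__canonical__measure_function_Measure
    mu (measurable_affine_fun a c%:num)).

(** Half-open intervals determine Lebesgue measure, and the preimage of []x, y]] has length (y -
    x)/c, which the scaling by c undoes. *)
Lemma affine_measureE (a : R) (c : {nonneg R}) (A : set (measurableTypeR R)) :
  (0 < c%:num)%R -> measurable A -> affine_measure a c A = mu A.
Proof.
move=> c0 mA; apply/esym/lebesgue_measure_unique => //.
move=> X [/= -[x y] _ <-].
rewrite /affine_measure/= /mscale/= /pushforward.
have -> : affine_fun a c%:num @^-1` `]x, y] = `]((x - a) / c%:num)%R, ((y - a) / c%:num)%R]%classic.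
  apply/seteqP; split => z /=; rewrite /affine_fun !in_itv/= ltr_pdivrMr// ler_pdivlMr//; lra.
rewrite !lebesgue_measure_itv/= !lte_fin ltr_pM2r ?invr_gt0// ltrD2r.
case: ifPn => _; last by rewrite mule0.
by rewrite -!EFinB -EFinM; congr (_%:E); field; rewrite gt_eqF.
Qed.

Lemma ge0_integral_affine (f : R -> \bar R) (a c : R) : (0 < c)%R ->
  measurable_fun [set: R] f -> (forall x, 0 <= f x) ->
  c%:E * \int[mu]_x f (a + c * x)%R = \int[mu]_x f x.
Proof.
move=> c0 mf f0.
pose cn := NngNum (ltW c0).
transitivity (\int[affine_measure a cn]_x f x).
  rewrite ge0_integral_mscale//=; congr (_ * _).
  rewrite (@ge0_integral_pushforward _ _ _ _ _ (affine_fun a c))//.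
  exact: measurable_affine_fun.
by apply: eq_measure_integral => A mA _; exact: affine_measureE.
Qed.

End Affine.

Section BetaGamma.
Context {R : realType}.
Notation mu := (@lebesgue_measure R).

(* The kernel of I^b extended by 0 to x <= 0: integrals over [0,t] become convolutions on R. *)
Definition pk (b x : R) : R := if 0 < x then x `^ (b - 1) else 0.

Lemma pk_gt0E (b x : R) : 0 < x -> pk b x = x `^ (b - 1).
Proof. by rewrite /pk => ->. Qed.

Lemma pk_le0 (b x : R) : x <= 0 -> pk b x = 0.
Proof. by rewrite /pk ltNge => ->. Qed.

Lemma pk_ge0 (b x : R) : 0 <= pk b x.
Proof. by rewrite /pk; case: ifP => // _; exact: powR_ge0. Qed.

Lemma measurable_pk (b : R) : measurable_fun [set: R] (pk b).
Proof.
by apply: measurable_fun_ifT => //; exact: measurable_fun_ltr.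
Qed.

Lemma pkZ (b c x : R) : 0 < c -> pk b (c * x) = c `^ (b - 1) * pk b x.
Proof.
move=> c0; rewrite /pk pmulr_rgt0//; case: ifPn => [x0|_]; last by rewrite mulr0.
by rewrite powRM// ltW.
Qed.

Lemma pkD (a b x : R) : pk a x * pk b x * x = pk (a + b) x.
Proof.
rewrite /pk; case: ifPn => [x0|_]; last by rewrite !mul0r.
rewrite -{3}[x]powRr1 ?ltW// -!powRD ?(gt_eqF x0) ?implybT//.
by congr (_ `^ _); ring.
Qed.

Lemma measurable_pkB (b t : R) : measurable_fun [set: R] (fun x => pk b (t - x)).
Proof.
apply: (measurableT_comp (measurable_pk b)).
exact: measurable_funB.
Qed.

Local Open Scope ereal_scope.

(* Extended-real integrals, so that Tonelli applies before finiteness is known. *)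
Definition Be (a b : R) : \bar R := \int[mu]_x (pk a (1 - x) * pk b x)%:E.

Definition Ge (b : R) : \bar R := \int[mu]_x (pk b x * expR (- x))%:E.

Lemma Be_ge0 a b : 0 <= Be a b.
Proof. by apply: integral_ge0 => x _; rewrite lee_fin mulr_ge0// pk_ge0. Qed.

Lemma Ge_ge0 b : 0 <= Ge b.
Proof. by apply: integral_ge0 => x _; rewrite lee_fin mulr_ge0// ?pk_ge0// expR_ge0. Qed.

Lemma measurable_conv a b (t : R) :
  measurable_fun [set: R] (fun x => pk a (t - x) * pk b x)%R.
Proof. by apply: measurable_funM; [exact: measurable_pkB|exact: measurable_pk]. Qed.

(** Homogeneity: for t > 0 the substitution x = t u pulls out t^(a+b-1). For t <= 0 one of the two
    kernels vanishes at every x. [Be a b] may still be infinite here. *)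
Lemma conv_pk (a b t : R) :
  \int[mu]_x (pk a (t - x) * pk b x)%:E = Be a b * (pk (a + b) t)%:E.
Proof.
have [t0|t0] := ltP 0%R t; last first.
  rewrite (pk_le0 _ _ t0) mule0 integral0_eq// => x _.
  have [x0|x0] := leP x 0%R; first by rewrite (pk_le0 b _ x0) mulr0.
  rewrite (pk_le0 a) ?mul0r//; lra.
rewrite -(@ge0_integral_affine _ _ 0 t t0)//; last 2 first.
- by apply/measurable_EFinP; exact: measurable_conv.
- by move=> x; rewrite lee_fin mulr_ge0// pk_ge0.
under eq_integral => x _.
  rewrite add0r (_ : t - t * x = t * (1 - x))%R; last by ring.
  rewrite !pkZ// (_ : _ * _ * _ = t `^ (a - 1) * t `^ (b - 1) * (pk a (1 - x) * pk b x))%R; last by ring.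
  rewrite EFinM.
over.
rewrite ge0_integralZl_EFin//; last 3 first.
- by move=> x _; rewrite lee_fin mulr_ge0// pk_ge0.
- by apply/measurable_EFinP; exact: measurable_conv.
- by rewrite mulr_ge0// powR_ge0.
rewrite -/(Be a b) muleA -EFinM muleC; congr (_ * _%:E).
by rewrite -pkD !pk_gt0E//; ring.
Qed.

Lemma conv_pkB (a b t y : R) :
  \int[mu]_x (pk a (t - x) * pk b (x - y))%:E = Be a b * (pk (a + b) (t - y))%:E.
Proof.
rewrite -conv_pk -(@ge0_integral_affine _ _ y 1)//; last 2 first.
- apply/measurable_EFinP; apply: measurable_funM; first exact: measurable_pkB.
  by apply: (measurableT_comp (measurable_pk b)); exact: measurable_funB.
- by move=> x; rewrite lee_fin mulr_ge0// pk_ge0.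
rewrite mul1e; apply: eq_integral => x _.
by congr (pk _ _ * pk _ _)%:E; ring.
Qed.

(** Tonelli for pk_a(y - x) pk_b(x) e^(-y): integrating first in y, after the shift y = x + u,
    separates the two gamma integrals; integrating first in x produces the convolution [conv_pk]. *)
Lemma GeM (a b : R) : Ge a * Ge b = Be a b * Ge (a + b).
Proof.
pose f (z : R * R) : \bar R := (pk a (z.2 - z.1) * pk b z.1 * expR (- z.2))%:E.
have mf : measurable_fun [set: R * R] f.
  apply/measurable_EFinP; apply: measurable_funM; first apply: measurable_funM.
  - apply: (measurableT_comp (measurable_pk a)); apply: measurable_funB.
      exact: measurable_snd.
    exact: measurable_fst.
  - exact: (measurableT_comp (measurable_pk b) measurable_fst).
  - by do 2 apply: measurableT_comp => //.
have f0 z : 0 <= f z by rewrite lee_fin !mulr_ge0 ?pk_ge0 ?expR_ge0.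
have := @fubini_tonelli _ _ _ _ _ mu mu f mf f0.
have -> : \int[mu]_x \int[mu]_y f (x, y) = Ge a * Ge b.
  rewrite -ge0_integralZl//; last 3 first.
  - by apply/measurable_EFinP; apply: measurable_funM; [exact: measurable_pk|exact: measurableT_comp].
  - by move=> x _; rewrite lee_fin mulr_ge0// ?pk_ge0// expR_ge0.
  - exact: Ge_ge0.
  apply: eq_integral => x _.
  rewrite -(@ge0_integral_affine _ _ x 1)//; last first.
    exact: (measurableT_comp mf (measurable_pair1 x)).
  rewrite mul1e muleC /Ge -ge0_integralZl_EFin//; last 3 first.
  - by move=> y _; rewrite lee_fin mulr_ge0// ?pk_ge0// expR_ge0.
  - by apply/measurable_EFinP; apply: measurable_funM; [exact: measurable_pk|exact: measurableT_comp].
  - by rewrite mulr_ge0// ?pk_ge0// expR_ge0.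
  apply: eq_integral => y _; rewrite /f/= -EFinM; congr (_%:E).
  by rewrite mul1r addrAC subrr add0r opprD expRD; ring.
move=> ->.
rewrite /Ge -ge0_integralZl//; last 3 first.
- by apply/measurable_EFinP; apply: measurable_funM; [exact: measurable_pk|exact: measurableT_comp].
- by move=> x _; rewrite lee_fin mulr_ge0// ?pk_ge0// expR_ge0.
- exact: Be_ge0.
apply: eq_integral => y _.
rewrite EFinM muleA -conv_pk -ge0_integralZr//.
- by apply/measurable_EFinP; exact: measurable_conv.
- by move=> x _; rewrite lee_fin mulr_ge0// pk_ge0.
Qed.

(** The primitive x^b / b is used on [1/(i+1), 1], away from the singularity, and i tends to
    infinity by monotone convergence. With [GeM] at a = 1 this yields the recursion of Gamma without
    integrating by parts. *)
Lemma Be1 (b : R) : (0 < b)%R -> Be 1 b = (b^-1)%:E.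
Proof.
move=> b0.
have -> : Be 1 b = \int[mu]_(x in `]0%R, 1%R]) (x `^ (b - 1))%:E.
  rewrite -integral_itv_bndo_bndc.
    rewrite integral_mkcond; apply: eq_integral => x _; rewrite patchE.
    case: ifPn => [|/negP]; rewrite in_setE/= in_itv/=.
      move=> /andP[x0 x1]; rewrite !pk_gt0E ?subr_gt0//.
      by rewrite subrr powRr0 mul1r.
    move=> /negP; rewrite negb_and -!leNgt => /orP[x0|x1].
      by rewrite (pk_le0 b) ?mulr0.
    by rewrite (pk_le0 1) ?mul0r// subr_le0.
  by apply/measurable_EFinP; apply: measurable_funTS; exact: measurable_powR.
pose S (i : nat) : set R := `[(i.+1%:R)^-1%R, 1%R]%classic.
have US : \bigcup_i S i = `]0%R, 1%R]%classic.
  apply/seteqP; split => [x [i _]|x]; rewrite /S/= !in_itv/=.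
    by move=> /andP[ix ->]; rewrite andbT; apply: lt_le_trans ix; rewrite invr_gt0.
  move=> /andP[x0 x1]; have [k kx] := ltr_add_invr x0.
  by exists k => //=; rewrite in_itv/= x1 andbT ltW//; move: kx; rewrite add0r.
have mS i : measurable (S i) by exact: measurable_itv.
have : \int[mu]_(x in S i) (x `^ (b - 1))%:E @[i --> \oo] --> \int[mu]_(x in \bigcup_i S i) (x `^ (b - 1))%:E.
  apply: ge0_nondecreasing_set_cvg_integral => //.
  - move=> i j ij; apply/subsetPset; apply: subset_itvr; rewrite bnd_simp.
    by rewrite lef_pV2 ?posrE// ler_nat.
  - by move=> i; apply/measurable_EFinP; apply: measurable_funTS; exact: measurable_powR.
  - by move=> i x _; rewrite lee_fin powR_ge0.
rewrite US => h; apply: (cvg_unique _ h) => //.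
have -> : (fun i => \int[mu]_(x in S i) (x `^ (b - 1))%:E) =
    (fun i => (b^-1 - b^-1 * (i.+1%:R^-1) `^ b)%:E)%R.
  apply/funext => -[|i].
    by rewrite /S invr1 set_itv1 integral_set1 powR1 mulr1 subrr.
  have i1 : (i.+2%:R^-1 < 1 :> R)%R by rewrite invf_lt1// ltr1n.
  have i0 : (0 < i.+2%:R^-1 :> R)%R by rewrite invr_gt0.
  rewrite (@continuous_FTC2 _ _ (fun x => b^-1 * x `^ b)%R)//.
  - by rewrite powR1 mulr1 EFinB.
  - apply: continuous_in_subspaceT => x; rewrite inE/= in_itv/= => /andP[x0 _].
    apply: differentiable_continuous; apply/derivable1_diffP.
    by apply: derivable_powR; rewrite in_itv/= andbT; exact: lt_le_trans x0.
  - have d (x : R) : (0 < x)%R -> derivable (fun x => b^-1 * x `^ b)%R x 1.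
      move=> x0; apply: derivableM; first exact: derivable_cst.
      by apply: derivable_powR; rewrite in_itv/= andbT.
    have c (x : R) : (0 < x)%R -> {for x, continuous (fun x => b^-1 * x `^ b)%R}.
      move=> x0; apply: differentiable_continuous; apply/derivable1_diffP; exact: d.
    split.
    + by move=> x; rewrite in_itv/= => /andP[x0 _]; apply: d; exact: lt_trans x0.
    + by apply: cvg_at_right_filter; exact: c.
    + by apply: cvg_at_left_filter; exact: c.
  - move=> x; rewrite in_itv/= => /andP[x0 _].
    have x0' : (0 < x)%R by exact: lt_trans x0.
    rewrite derive1E deriveM//; [|by apply: derivable_powR; rewrite in_itv/= andbT].
    rewrite -derive1E powR_derive1 ?in_itv/= ?andbT//.
    rewrite derive_cst scaler0 addr0 /GRing.scale/= mulrA mulVf ?mul1r//.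
    by rewrite gt_eqF.
apply/fine_cvgP; split; first by near=> i.
have : (b^-1 - b^-1 * (n.+1%:R^-1) `^ b)%R @[n --> \oo] --> (b^-1 - b^-1 * 0)%R.
  apply: cvgB; first exact: cvg_cst.
  apply: cvgMr.
  have := powR_cvg0 b0 => /cvg_at_rightP; apply; split => //.
  exact: cvg_harmonic.
by rewrite mulr0 subr0.
Unshelve. all: by end_near. Qed.

Lemma Ge_itv (b : R) : Ge b = \int[mu]_(x in `]0%R, +oo[) (x `^ (b - 1) * expR (- x))%:E.
Proof.
rewrite integral_mkcond; apply: eq_integral => x _; rewrite patchE.
case: ifPn => [|/negP]; rewrite in_setE/= in_itv/= andbT.
  by move=> x0; rewrite pk_gt0E.
by move=> /negP; rewrite -leNgt => x0; rewrite pk_le0// mul0r.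
Qed.

Lemma Ge1 : Ge 1 = 1.
Proof.
rewrite Ge_itv integral_itv_obnd_cbnd; last first.
  apply/measurable_EFinP; apply: measurable_funTS; apply: measurable_funM.
    exact: measurable_powR.
  exact: measurableT_comp.
rewrite -(integral_exponential_pdf (@ltr01 R)) [RHS](_ : _ =
   \int[mu]_(x in `[0%R, +oo[) (exponential_pdf 1 x)%:E)%E.
  apply: eq_integral => x; rewrite inE/= in_itv/= andbT => x0.
  by rewrite exponential_pdfE// subrr powRr0 mulN1r.
rewrite [RHS]integral_mkcond; apply: eq_integral => x _; rewrite patchE.
case: ifPn => [|/negP]; rewrite in_setE/= in_itv/= andbT// => /negP.
by rewrite -ltNge => x0; rewrite lt0_exponential_pdf.
Qed.

Lemma GeS (b : R) : (0 < b)%R -> Ge (1 + b) = b%:E * Ge b.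
Proof.
move=> b0; have := GeM 1 b; rewrite Ge1 mul1e Be1// => ->.
by rewrite muleA -EFinM divff ?gt_eqF// mul1e.
Qed.

Lemma Ge_gt0 (b : R) : (0 < b)%R -> 0 < Ge b.
Proof.
(* On [1,2] the integrand is at least this constant: x^(b-1) >= x^(-1) >= 1/2 because b > 0, and
   e^(-x) >= e^(-2). *)
move=> b0; pose c := (2^-1 * expR (- 2) : R)%R.
apply: (@lt_le_trans _ _ (\int[mu]_(x in `[1%R, 2%R]) c%:E)).
  rewrite integral_cst//= lebesgue_measure_itv/= lte_fin ltr1n -EFinB -EFinM lte_fin.
  by rewrite !mulr_gt0 ?expR_gt0// subr_gt0 ltr1n.
rewrite integral_mkcond; apply: ge0_le_integral => //.
- by move=> x _; rewrite patchE; case: ifP => // _; rewrite lee_fin mulr_ge0// expR_ge0.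
- by apply/(measurable_restrictT _ _).1 => //.
- by apply/measurable_EFinP; apply: measurable_funM; [exact: measurable_pk|exact: measurableT_comp].
move=> x _; rewrite patchE; case: ifPn => [|_]; last first.
  by rewrite lee_fin mulr_ge0// ?pk_ge0// expR_ge0.
rewrite in_setE/= in_itv/= lee_fin => /andP[x1 x2].
have x0 : (0 < x)%R by exact: lt_le_trans x1.
rewrite /c; apply: ler_pM => //.
  rewrite pk_gt0E//; apply: (@le_trans _ _ (x `^ (-1))%R).
    by rewrite (powR_inv1 (ltW x0)) lef_pV2 ?posrE.
  by apply: ler_powR => //; lra.
by rewrite ler_expR lerN2.
Qed.

(** For b in (0,1] the integrand is dominated by x^(b-1) below 1 and by e^(-x) above 1, that is, by
    the integrands of [Be 1 b] and [Ge 1] together. The recursion [GeS] carries finiteness to larger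
    b. *)
Lemma Ge_lty (b : R) : (0 < b)%R -> Ge b < +oo.
Proof.
have small (c : R) : (0 < c <= 1)%R -> Ge c < +oo.
  move=> /andP[c0 c1]; apply: (@le_lt_trans _ _ (Be 1 c + Ge 1)); last first.
    by rewrite Be1// Ge1 -EFinD ltry.
  have mGe a : measurable_fun [set: R] (fun x => (pk a x * expR (- x))%:E).
    by apply/measurable_EFinP; apply: measurable_funM; [exact: measurable_pk|exact: measurableT_comp].
  have gGe a x : 0 <= (pk a x * expR (- x))%:E by rewrite lee_fin mulr_ge0// ?pk_ge0// expR_ge0.
  have mc : measurable_fun [set: R] (fun x => (pk 1 (1 - x) * pk c x)%:E).
    by apply/measurable_EFinP; exact: measurable_conv.
  have gc x : 0 <= (pk 1 (1 - x) * pk c x)%:E by rewrite lee_fin mulr_ge0// pk_ge0.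
  have mc1 := mGe 1%R; have mcc := mGe c.
  rewrite /Be /Ge -ge0_integralD//.
  apply: ae_ge0_le_integral => //.
  - by move=> x _; rewrite adde_ge0.
  - exact: emeasurable_funD.
  exists [set 1%R]; split; [exact: measurable_set1|exact: lebesgue_measure_set1|].
  move=> x /=; apply: contra_notP => /eqP x1 _; rewrite -EFinD lee_fin.
  have [x0|x0] := leP x 0%R; first by rewrite !(pk_le0 _ _ x0) mulr0 !mul0r addr0.
  case: (ltgtP x 1%R) x1 => // x1 _.
    rewrite [pk 1 (1 - x)]pk_gt0E ?subr_gt0// subrr powRr0 mul1r -[leLHS]addr0.
    apply: lerD; last by rewrite mulr_ge0 ?pk_ge0// expR_ge0.
    by rewrite ler_piMr ?pk_ge0// -expR0 ler_expR; lra.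
  rewrite [pk 1 (1 - x)]pk_le0 ?mul0r ?add0r; last by lra.
  rewrite ler_wpM2r ?expR_ge0// !pk_gt0E//.
  by apply: ler_powR; lra.
have ind n (c : R) : (0 < c <= n%:R)%R -> Ge c < +oo.
  elim: n c => [|n IHn] c /andP[c0 cn]; first by move: (lt_le_trans c0 cn); rewrite ltxx.
  have [c1|c1] := leP c 1%R; first by apply: small; rewrite c0.
  have c10 : (0 < c - 1)%R by rewrite subr_gt0.
  rewrite (_ : c = 1 + (c - 1))%R ?GeS//; last by ring.
  rewrite lte_mul_pinfty// ?lee_fin ?ltW//.
  by apply: IHn; rewrite c10/= lerBlDr natr1.
move=> b0; apply: (ind (Num.truncn b).+1); rewrite b0/= ltW//.
by rewrite -truncn_lt_nat// ltW.
Qed.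

Lemma GammaE (b : R) : (0 < b)%R -> (Gamma b)%:E = Ge b.
Proof.
move=> b0; rewrite /Gamma /Rintegral -Ge_itv fineK// ge0_fin_numE ?Ge_lty//.
exact: Ge_ge0.
Qed.

Lemma Gamma_gt0 (b : R) : (0 < b)%R -> (0 < Gamma b)%R.
Proof. by move=> b0; rewrite -lte_fin GammaE// Ge_gt0. Qed.

Lemma Gamma1 : Gamma 1 = 1%R :> R.
Proof. by apply: EFin_inj; rewrite GammaE// Ge1. Qed.

Lemma GammaS (b : R) : (0 < b)%R -> Gamma (b + 1) = (b * Gamma b)%R.
Proof.
move=> b0; apply: EFin_inj; rewrite GammaE ?addr_gt0// addrC GeS// EFinM GammaE//.
Qed.

Lemma Gamma_nat (j : nat) : Gamma j.+1%:R = j`!%:R :> R.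
Proof.
elim: j => [|j IHj]; first exact: Gamma1.
by rewrite -[in LHS]natr1 GammaS// IHj factS natrM.
Qed.

Definition beta (a b : R) : R := (Gamma a * Gamma b / Gamma (a + b))%R.

(** Finiteness comes from [GeM]: an infinite [Be a b] times the positive Gamma(a+b) would be
    infinite, while the other side is finite. *)
Lemma BeE (a b : R) : (0 < a)%R -> (0 < b)%R -> Be a b = (beta a b)%:E.
Proof.
move=> a0 b0; have ab0 : (0 < a + b)%R by rewrite addr_gt0.
have := GeM a b; rewrite -!GammaE// -EFinM.
have := Be_ge0 a b; case: (Be a b) => [r _| |//].
  rewrite -EFinM => hE; have h := EFin_inj hE; congr (_%:E).
  by rewrite /beta h mulfK// (gt_eqF (Gamma_gt0 _ ab0)).
by rewrite gt0_mulye// lte_fin Gamma_gt0.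
Qed.

(* The integral over [N, N + 1] alone; N is free, so Gamma grows faster than any geometric sequence. *)
Lemma Gamma_lower_bound (N : nat) (s : R) : (0 < N)%N -> (1 <= s)%R ->
  (N%:R `^ (s - 1) * expR (- N.+1%:R) <= Gamma s)%R.
Proof.
move=> N0 s1; rewrite -lee_fin GammaE; last by exact: lt_le_trans s1.
have -> : (N%:R `^ (s - 1) * expR (- N.+1%:R) : R)%:E = \int[mu]_(x in `[N%:R : R, N.+1%:R]) (N%:R `^ (s - 1) * expR (- N.+1%:R))%:E.
  rewrite integral_cst//= lebesgue_measure_itv/= lte_fin ltr_nat ltnSn -EFinB.
  by rewrite -natrB// subSnn mule1.
rewrite integral_mkcond; apply: ge0_le_integral => //.
- by move=> x _; rewrite patchE; case: ifP => // _; rewrite lee_fin mulr_ge0// ?expR_ge0 ?powR_ge0.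
- by apply/(measurable_restrictT _ _).1 => //.
- by apply/measurable_EFinP; apply: measurable_funM; [exact: measurable_pk|exact: measurableT_comp].
move=> x _; rewrite patchE; case: ifPn => [|_]; last first.
  by rewrite lee_fin mulr_ge0// ?pk_ge0// expR_ge0.
rewrite in_setE/= in_itv/= lee_fin => /andP[x1 x2].
have N0' : (0 < N%:R :> R)%R by rewrite ltr0n.
have x0 : (0 < x)%R by exact: lt_le_trans x1.
apply: ler_pM => //.
  rewrite pk_gt0E//; apply: ge0_ler_powR => //; rewrite ?nnegrE ?subr_ge0//.
  exact: ltW.
by rewrite ler_expR lerN2.
Qed.

End BetaGamma.

(** * Convolution of two power kernels with a bounded weight *)

Section Convolution.
Context {R : realType}.
Notation mu := (@lebesgue_measure R).
Implicit Types (a b c t M : R) (w : R -> R).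

Lemma integrable_ge0_lty (d : measure_display) (X : measurableType d)
    (m : {measure set X -> \bar R}) (f : X -> R) :
  measurable_fun setT f -> (forall x, 0 <= f x) ->
  (\int[m]_x (f x)%:E < +oo)%E -> m.-integrable setT (EFin \o f).
Proof.
move=> mf f0 fy; apply/integrableP; split; first exact/measurable_EFinP.
by under eq_integral => x _ do rewrite /= ger0_norm//.
Qed.

Lemma integrable_conv_pkB a b t y : 0 < a -> 0 < b ->
  mu.-integrable setT (EFin \o (fun x => pk a (t - x) * pk b (x - y))).
Proof.
move=> a0 b0; apply: integrable_ge0_lty.
- apply: measurable_funM; first exact: measurable_pkB.
  by apply: (measurableT_comp (measurable_pk b)); exact: measurable_funB.
- by move=> x; rewrite mulr_ge0// pk_ge0.
- by rewrite conv_pkB BeE// -EFinM ltry.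
Qed.

Lemma measurable_kconv b c t w : measurable_fun [set: R] w ->
  measurable_fun [set: R] (fun x => pk b (t - x) * pk c x * w x).
Proof. by move=> mw; apply: measurable_funM => //; exact: measurable_conv. Qed.

Lemma integrable_kconv b c t w M : 0 < b -> 0 < c ->
  measurable_fun [set: R] w -> (forall x, `|w x| <= M) ->
  mu.-integrable setT (EFin \o (fun x => pk b (t - x) * pk c x * w x)).
Proof.
move=> b0 c0 mw wM.
apply: (@le_integrable _ _ _ mu setT _ _ (fun x => M%:E * (pk b (t - x) * pk c (x - 0))%:E)%E) => //.
- by apply/measurable_EFinP; exact: measurable_kconv.
- move=> x _; rewrite /= lee_fin subr0 normrM mulrC (ger0_norm (mulr_ge0 (pk_ge0 _ _) (pk_ge0 _ _))).
  apply: (@le_trans _ _ (M * (pk b (t - x) * pk c x))); last exact: ler_norm.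
  by rewrite ler_wpM2r// mulr_ge0 ?pk_ge0.
- by apply: integrableZl => //; exact: integrable_conv_pkB.
Qed.

(** Up to the factor 1/Gamma(b) this is I^b of t^(c-1) w(t). The singular power is kept apart from
    the bounded factor w, so that every domination is by a beta integral. *)
Definition kconv b c w t : R := \int[mu]_x (pk b (t - x) * pk c x * w x).

Lemma kconv_EFin b c t w M : 0 < b -> 0 < c ->
  measurable_fun [set: R] w -> (forall x, `|w x| <= M) ->
  (\int[mu]_x (pk b (t - x) * pk c x * w x)%:E = (kconv b c w t)%:E)%E.
Proof.
move=> b0 c0 mw wM; rewrite /kconv /Rintegral fineK//.
by apply: integrable_fin_num => //; exact: integrable_kconv wM.
Qed.

Lemma Rintegral_affine (f : R -> R) (a c : R) : 0 < c ->
  mu.-integrable setT (EFin \o f) ->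
  \int[mu]_x f x = c * \int[mu]_x f (a + c * x).
Proof.
move=> c0 intf; have mf := measurable_int mu intf.
have /measurable_EFinP mfR := mf.
pose g := EFin \o (fun x => f (a + c * x)).
have Ep : (\int[mu]_x ((EFin \o f)^\+ x) = c%:E * \int[mu]_x (g^\+ x))%E.
  rewrite -(ge0_integral_affine _ a c c0 (measurable_funepos mf) (funepos_ge0 (EFin \o f))).
  by congr mule; apply: eq_integral => x _; rewrite !funeposE.
have En : (\int[mu]_x ((EFin \o f)^\- x) = c%:E * \int[mu]_x (g^\- x))%E.
  rewrite -(ge0_integral_affine _ a c c0 (measurable_funeneg mf) (funeneg_ge0 (EFin \o f))).
  by congr mule; apply: eq_integral => x _; rewrite !funenegE.
have fin (x : \bar R) : (0 <= x)%E -> (c%:E * x < +oo)%E -> x \is a fin_num.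
  case: x => // _; by rewrite gt0_muley ?lte_fin// ltxx.
have fp : (\int[mu]_x (g^\+ x))%E \is a fin_num.
  apply: fin; first by apply: integral_ge0 => x _; exact: funepos_ge0.
  by rewrite -Ep; exact: integral_funepos_lt_pinfty.
have fn : (\int[mu]_x (g^\- x))%E \is a fin_num.
  apply: fin; first by apply: integral_ge0 => x _; exact: funeneg_ge0.
  by rewrite -En; exact: integral_funeneg_lt_pinfty.
rewrite /Rintegral.
change (fine (\int[mu]_x (EFin \o f) x)%E = c * fine (\int[mu]_x g x)%E).
rewrite [in LHS]integralE [in RHS]integralE Ep En.
have key (A B : \bar R) : A \is a fin_num -> B \is a fin_num ->
    fine (c%:E * A - c%:E * B)%E = c * fine (A - B)%E.
  by case: A => // A _; case: B => // B _; rewrite -!EFinM -!EFinB/= mulrBr.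
exact: key.
Qed.

(** The substitution x = t u moves all singular dependence on t into [pk (b + c) t]; in the
    remaining integral t occurs only inside w. *)
Lemma kconv_scale b c t w M : 0 < b -> 0 < c ->
  measurable_fun [set: R] w -> (forall x, `|w x| <= M) ->
  kconv b c w t = pk (b + c) t * kconv b c (fun x => w (t * x)) 1.
Proof.
move=> b0 c0 mw wM; have [t0|t0] := leP t 0.
  rewrite (pk_le0 _ _ t0) mul0r /kconv /Rintegral integral0_eq// => x _; congr EFin.
  have [x0|x0] := leP x 0; first by rewrite (pk_le0 c _ x0) mulr0 mul0r.
  rewrite (pk_le0 b) ?mul0r//; lra.
rewrite {1}/kconv (@Rintegral_affine _ 0 t)//; last exact: integrable_kconv wM.
have mw' : measurable_fun [set: R] (fun x => w (t * x)) by exact: measurableT_comp.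
have E x : pk b (t - (0 + t * x)) * pk c (0 + t * x) * w (0 + t * x) =
   (t `^ (b - 1) * t `^ (c - 1)) * (pk b (1 - x) * pk c x * w (t * x)).
  by rewrite add0r -{1}[t]mulr1 -mulrBr !pkZ//; ring.
under eq_Rintegral => x _ do rewrite E.
rewrite RintegralZl//; last by apply: (integrable_kconv _ _ _ _ M).
by rewrite -/(kconv b c (fun x => w (t * x)) 1) mulrA -pkD !pk_gt0E//; ring.
Qed.

(** Dominated convergence: M times the beta integrand is a majorant that does not depend on t. *)
Lemma continuous_kconv_scale b c w M : 0 < b -> 0 < c ->
  continuous w -> (forall x, `|w x| <= M) ->
  continuous (fun t => kconv b c (fun x => w (t * x)) 1).
Proof.
move=> b0 c0 cw wM t.
have mw t' : measurable_fun [set: R] (fun x => w (t' * x)).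
  by apply: continuous_measurable_fun => x; apply: continuous_comp; [exact: mulrl_continuous|exact: cw].
have := @continuity_under_integral R _ _ mu (fun t x => pk b (1 - x) * pk c x * w (t * x)) setT measurableT (t - 1) (t + 1).
have t1 : t \in `]t - 1, t + 1[%classic by rewrite inE/= in_itv/=; apply/andP; split; lra.
move=> /(_ _ _ (fun x => M * (pk b (1 - x) * pk c (x - 0))) _ _ t t1); apply.
- by move=> x _; apply: (integrable_kconv _ _ _ _ M).
- apply/aeW => y _ x _; apply: cvgM; first exact: cvg_cst.
  by apply: continuous_comp; [exact: mulrr_continuous|exact: cw].
- have := @integrableZl _ _ _ mu setT measurableT M _ (integrable_conv_pkB b c 1 0 b0 c0).
  by apply: eq_integrable => // x _; rewrite /= EFinM.
- move=> x _; apply/aeW => y _; rewrite subr0 normrM mulrC (ger0_norm (mulr_ge0 (pk_ge0 _ _) (pk_ge0 _ _))).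
  by rewrite ler_wpM2r// mulr_ge0 ?pk_ge0.
Qed.

(** Fubini. Integrability on the plane is checked for the nonnegative kernel product [G] by two beta
    integrals, and M times [G] dominates the weighted product [F]. *)
Lemma kconv_semigroup a b c w M t : 0 < a -> 0 < b -> 0 < c ->
  measurable_fun [set: R] w -> (forall x, `|w x| <= M) ->
  \int[mu]_x (pk a (t - x) * kconv b c w x) = beta a b * kconv (a + b) c w t.
Proof.
move=> a0 b0 c0 mw wM.
pose G (z : R * R) := pk a (t - z.1) * (pk b (z.1 - z.2) * pk c z.2).
pose F (z : R * R) := G z * w z.2.
have m2 (f : R -> R) : measurable_fun [set: R] f -> measurable_fun [set: R * R] (fun z => f z.2).
  by move=> mf; apply: measurableT_comp.
have mG : measurable_fun [set: R * R] G.
  apply: measurable_funM; last apply: measurable_funM.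
  - exact: (measurableT_comp (measurable_pkB a t) measurable_fst).
  - by apply: (measurableT_comp (measurable_pk b)); exact: measurable_funB.
  - exact: m2 (measurable_pk c).
have mF : measurable_fun [set: R * R] F by apply: measurable_funM => //; exact: m2.
have G0 z : 0 <= G z by rewrite !mulr_ge0 ?pk_ge0.
have iG : (mu \x mu)%E.-integrable setT (EFin \o G).
  apply/integrable12ltyP; first exact/measurable_EFinP.
  have E x : (\int[mu]_y `|(EFin \o G) (x, y)| = (beta b c)%:E * (pk a (t - x) * pk (b + c) (x - 0))%:E)%E.
    transitivity (\int[mu]_y ((pk a (t - x))%:E * (pk b (x - y) * pk c y)%:E))%E.
      by apply: eq_integral => y _; rewrite /= ger0_norm// -EFinM.
    rewrite ge0_integralZl_EFin ?pk_ge0//; last 2 first.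
    - by move=> y _; rewrite lee_fin mulr_ge0 ?pk_ge0.
    - by apply/measurable_EFinP; exact: measurable_conv.
    by rewrite conv_pk BeE// subr0 -!EFinM; congr EFin; ring.
  under eq_integral => x _ do rewrite E.
  rewrite integralZl//; last by apply: integrable_conv_pkB => //; exact: addr_gt0.
  by rewrite conv_pkB BeE ?addr_gt0// -!EFinM ltry.
have iF : (mu \x mu)%E.-integrable setT (EFin \o F).
  have iMG := integrableZl measurableT M iG.
  apply: (le_integrable measurableT _ _ iMG).
  - exact/measurable_EFinP.
  - move=> z _; rewrite /= lee_fin normrM mulrC (ger0_norm (G0 z)).
    apply: (@le_trans _ _ (M * G z)); last exact: ler_norm.
    by rewrite ler_wpM2r.
have := Fubini iF.
have -> : (\int[mu]_x \int[mu]_y (EFin \o F) (x, y) = \int[mu]_x (pk a (t - x) * kconv b c w x)%:E)%E.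
  apply: eq_integral => x _.
  rewrite EFinM -(kconv_EFin _ _ _ _ M)// -integralZl//; last exact: integrable_kconv wM.
  by apply: eq_integral => y _; rewrite /= -EFinM /F /G/=; congr EFin; ring.
have -> : (\int[mu]_y \int[mu]_x (EFin \o F) (x, y) = \int[mu]_y (beta a b * (pk (a + b) (t - y) * pk c y * w y))%:E)%E.
  apply: eq_integral => y _.
  transitivity (\int[mu]_x ((pk a (t - x) * pk b (x - y))%:E * (pk c y * w y)%:E))%E.
    by apply: eq_integral => x _; rewrite /= -EFinM /F /G/=; congr EFin; ring.
  rewrite integralZr//; last exact: integrable_conv_pkB.
  by rewrite conv_pkB BeE// -!EFinM; congr EFin; ring.
rewrite {1}/Rintegral => ->.
rewrite /kconv -RintegralZl//.
by apply: (integrable_kconv _ _ _ _ M) => //; exact: addr_gt0.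
Qed.

Lemma kconvD b c t w1 w2 M1 M2 : 0 < b -> 0 < c ->
  measurable_fun [set: R] w1 -> (forall x, `|w1 x| <= M1) ->
  measurable_fun [set: R] w2 -> (forall x, `|w2 x| <= M2) ->
  kconv b c (fun x => w1 x + w2 x) t = kconv b c w1 t + kconv b c w2 t.
Proof.
move=> b0 c0 m1 h1 m2 h2; rewrite /kconv -RintegralD//.
- by apply: eq_Rintegral => x _; rewrite mulrDr.
- exact: integrable_kconv h1.
- exact: integrable_kconv h2.
Qed.

Lemma kconvZ b c t w M k : 0 < b -> 0 < c ->
  measurable_fun [set: R] w -> (forall x, `|w x| <= M) ->
  kconv b c (fun x => k * w x) t = k * kconv b c w t.
Proof.
move=> b0 c0 m1 h1; rewrite /kconv -RintegralZl//.
- by apply: eq_Rintegral => x _; rewrite mulrCA.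
- exact: integrable_kconv h1.
Qed.

(** Agreement is asked only on the open interval because endpoints are null; this hides the values
    of [powR] at 0, for instance 0^0 = 1 when the order is 1. *)
Lemma Rintegral_itv_extend (f : R -> R) (t : R) (h : R -> R) :
  measurable_fun [set: R] h ->
  (forall x : R, 0 < x < t -> f x = h x) ->
  (forall x : R, ~~ (0 < x < t) -> h x = 0) ->
  \int[mu]_(x in `[0, t]) f x = \int[mu]_x h x.
Proof.
move=> mh fh h0; rewrite /Rintegral.
rewrite (@eq_integral_itv_bounded _ 0 t h f true false); last 3 first.
- apply: (eq_measurable_fun h); last exact: measurable_funTS.
  by move=> x; rewrite inE/= in_itv/= => xt; rewrite fh.
- exact: measurable_funTS.
- by move=> x; rewrite in_itv/= => xt; rewrite fh.
rewrite [in LHS]integral_mkcond; congr fine; apply: eq_integral => x _; rewrite patchE.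
case: ifPn => [//|/negP]; rewrite in_setE/= in_itv/= => /negP xt.
rewrite [RHS]/= h0//; apply: contra xt => /andP[x0 xt]; by rewrite !ltW.
Qed.

End Convolution.

Set Implicit Arguments.
Unset Strict Implicit.

(** * Riemann-Liouville integrals of functions in C_gamma *)

Section Extension.
Context {R : realType}.

(** The retraction of the line onto [0,T]: composing with it turns a function continuous on [0,T]
    into a bounded continuous function on R. *)
Definition clamp (T x : R) : R := Num.max 0 (Num.min x T).

Lemma clamp_itv (T x : R) : 0 <= T -> 0 <= clamp T x <= T.
Proof. by move=> T0; rewrite /clamp le_max lexx/= ge_max T0 ge_min lexx orbT. Qed.

Lemma clamp_id (T x : R) : 0 <= x <= T -> clamp T x = x.
Proof. by move=> /andP[x0 xT]; rewrite /clamp (min_idPl xT) (max_idPr x0). Qed.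

Lemma continuous_clamp (T : R) : continuous (clamp T).
Proof.
have -> : clamp T = (fun x => ((x + T - `|x - T|) / 2 + `|(x + T - `|x - T|) / 2|) / 2).
  by apply/funext => x; rewrite /clamp maxr_absE minr_absE add0r sub0r normrN.
have c1 : continuous (fun x : R => (x + T - `|x - T|) / 2).
  move=> x; apply: cvgMl; apply: cvgB.
    by apply: cvgD; [exact: cvg_id|exact: cvg_cst].
  by apply: cvg_norm; apply: cvgB; [exact: cvg_id|exact: cvg_cst].
by move=> x; apply: cvgMl; apply: cvgD; [exact: c1|apply: cvg_norm; exact: c1].
Qed.

Lemma continuous_comp_clamp (T : R) (g : R -> R) : 0 <= T ->
  {within `[0, T], continuous g} -> continuous (g \o clamp T).
Proof.
move=> T0 /subspace_continuousP cg x.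
have cx : `[0, T]%classic (clamp T x) by rewrite /= in_itv/=; exact: clamp_itv.
apply: cvg_comp (cg _ cx) => A /= nA.
apply: (@filterS _ (nbhs x) _ (clamp T @^-1` [set t | `[0, T]%classic t -> A t]) (clamp T @^-1` A)).
  by move=> y /=; apply; rewrite in_itv/=; exact: clamp_itv.
exact: (@continuous_clamp T x _ nA).
Qed.

Lemma within_continuous_bounded (T : R) (g : R -> R) : 0 <= T ->
  {within `[0, T], continuous g} -> exists M : R, forall x, 0 <= x <= T -> `|g x| <= M.
Proof.
move=> T0 cg; have [c1 _ h1] := EVT_max T0 cg; have [c2 _ h2] := EVT_min T0 cg.
exists (`|g c1| + `|g c2|) => x xT.
have xT' : x \in `[0, T] by rewrite in_itv.
have {}h1 := h1 _ xT'; have {}h2 := h2 _ xT'.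
have := ler_norm (g c1); have := ler_norm (- g c2); rewrite normrN => n2 n1.
have := normr_ge0 (g c1); have := normr_ge0 (g c2) => p2 p1.
by rewrite ler_norml; apply/andP; split; lra.
Qed.

Lemma continuous_pk (b : R) : 1 < b -> continuous (pk b).
Proof.
move=> b1 x; have b10 : 0 < b - 1 by rewrite subr_gt0.
case: (ltgtP x 0) => [x0|x0|->].
- apply: (@near_cst_continuous _ _ 0); near=> y; apply: pk_le0; apply: ltW.
  by near: y; exact: lt_nbhsl.
- have c : {for x, continuous (fun y => y `^ (b - 1))}.
    apply: differentiable_continuous; apply/derivable1_diffP.
    by apply: derivable_powR; rewrite in_itv/= andbT.
  rewrite /prop_for/continuous_at pk_gt0E//.
  apply: cvg_trans c; apply: near_eq_cvg; near=> y.
  by rewrite pk_gt0E//; near: y; exact: lt_nbhsr.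
- apply/left_right_continuousP; rewrite pk_le0//; split.
    apply: cvg_near_cst; near=> y; apply: pk_le0; exact: ltW.
  apply: cvg_trans (powR_cvg0 b10); apply: near_eq_cvg; near=> y.
  by rewrite pk_gt0E.
Unshelve. all: by end_near. Qed.

End Extension.

Section WeightedSpace.
Context {R : realType}.
Variables (T gam : R).
Hypotheses (T0 : 0 < T) (gam01 : 0 < gam < 1).
Notation mu := (@lebesgue_measure R).
Implicit Types (f g k w u : R -> R) (b p t : R).
Let c := 1 - gam.
Let c0 : 0 < c. Proof. by rewrite subr_gt0; case/andP: gam01. Qed.
Let gam0 : 0 < gam. Proof. by case/andP: gam01. Qed.

Lemma gam_pkc t : 0 < t -> t `^ gam * pk c t = 1.
Proof.
move=> t0; rewrite pk_gt0E// -powRD; last by rewrite (gt_eqF t0) implybT.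
by rewrite (_ : _ + _ = 0) ?powRr0// /c; ring.
Qed.

Lemma CgammaP g : Cgamma T gam g <->
  exists w (M : R), [/\ continuous w, forall x, `|w x| <= M
    & forall t, 0 < t <= T -> g t = pk c t * w t].
Proof.
split=> [[g0 cg0 g0E]|[w [M [cw wM gE]]]].
  have [M hM] := within_continuous_bounded (ltW T0) cg0.
  exists (g0 \o clamp T), M; split.
  - exact: continuous_comp_clamp (ltW T0) cg0.
  - by move=> x; apply: hM; exact: clamp_itv (ltW T0).
  - move=> t tT; have /andP[t0 tT'] := tT.
    by rewrite /= clamp_id ?(ltW t0)// g0E// mulrCA mulrA gam_pkc// mul1r.
exists w; first exact: continuous_subspaceT.
by move=> t tT; have /andP[t0 _] := tT; rewrite gE// mulrA gam_pkc// mul1r.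
Qed.

Lemma Cgamma_eq f g : (forall t, 0 < t <= T -> f t = g t) ->
  Cgamma T gam f -> Cgamma T gam g.
Proof. by move=> fg [h ch hE]; exists h => // t tT; rewrite hE// fg. Qed.

Lemma CgammaD f g : Cgamma T gam f -> Cgamma T gam g ->
  Cgamma T gam (fun t => f t + g t).
Proof.
move=> [h ch hE] [h' ch' hE']; exists (fun t => h t + h' t).
  by move=> x; apply: cvgD; [exact: ch|exact: ch'].
by move=> t tT; rewrite hE// hE'// mulrDr.
Qed.

Lemma Cgamma_mul u f : {within `[0, T], continuous u} -> Cgamma T gam f ->
  Cgamma T gam (fun t => u t * f t).
Proof.
move=> cu [h ch hE]; exists (fun t => u t * h t).
  by move=> x; apply: cvgM; [exact: cu|exact: ch].
by move=> t tT; rewrite hE// mulrCA.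
Qed.

Lemma CgammaZ l f : Cgamma T gam f -> Cgamma T gam (fun t => l * f t).
Proof. by apply: Cgamma_mul => x; exact: cvg_cst. Qed.

Lemma CgammaN f : Cgamma T gam f -> Cgamma T gam (fun t => - f t).
Proof.
by move=> /(CgammaZ (-1)); apply: Cgamma_eq => t _; rewrite mulN1r.
Qed.

Lemma CgammaB f g : Cgamma T gam f -> Cgamma T gam g ->
  Cgamma T gam (fun t => f t - g t).
Proof. by move=> hf hg; apply: CgammaD => //; exact: CgammaN. Qed.

Lemma Cgamma0 : Cgamma T gam (fun=> 0).
Proof. by exists (fun=> 0) => [x|t _]; [exact: cvg_cst|rewrite mulr0]. Qed.

Lemma Cgamma_sum (I : eqType) (r : seq I) (F : I -> R -> R) :
  (forall i, i \in r -> Cgamma T gam (F i)) ->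
  Cgamma T gam (fun t => \sum_(i <- r) F i t).
Proof.
elim: r => [|i r IHr] hF.
  by apply: Cgamma_eq Cgamma0 => t _; rewrite big_nil.
apply: (@Cgamma_eq (fun t => F i t + \sum_(i <- r) F i t)).
  by move=> t _; rewrite big_cons.
apply: CgammaD; first by apply: hF; rewrite mem_head.
by apply: IHr => j jr; apply: hF; rewrite in_cons jr orbT.
Qed.

Lemma within_Cgamma f : {within `[0, T], continuous f} -> Cgamma T gam f.
Proof.
move=> cf; exists (fun t => pk (gam + 1) t * f t).
  move=> x; apply: cvgM; last exact: cf.
  by apply: continuous_subspaceT; apply: continuous_pk; rewrite ltrDr.
by move=> t /andP[t0 _]; rewrite pk_gt0E// addrK.
Qed.

(** The weighted function is a multiple of t^(gam+p-1). In the borderline case p = c it is constant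
    and is treated apart, because [pk 1] jumps at 0. *)
Lemma Phi_Cgamma p : c <= p -> Cgamma T gam (Phi p).
Proof.
move=> cp; have [<-|cp'] := eqVneq c p.
  exists (fun=> (Gamma c)^-1) => [x|t /andP[t0 _]]; first exact: cvg_cst.
  by rewrite /Phi -pk_gt0E// mulrA gam_pkc// mul1r.
exists (fun t => pk (gam + p) t / Gamma p).
  apply: continuous_subspaceT => x; apply: cvgMl; apply: continuous_pk.
  by rewrite -ltrBlDl lt_neqAle cp' cp.
move=> t /andP[t0 _]; rewrite /Phi pk_gt0E// mulrA -powRD; last by rewrite (gt_eqF t0) implybT.
by congr (_ `^ _ / _); ring.
Qed.

Lemma RLintE b g t : 0 < b -> RLint b g t = (Gamma b)^-1 *
  \int[mu]_(tau in `[0, t]) ((t - tau) `^ (b - 1) * g tau).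
Proof. by move=> b0; rewrite /RLint gt_eqF. Qed.

Lemma RLint_t0 b g : 0 < b -> RLint b g 0 = 0.
Proof. by move=> b0; rewrite RLintE// set_itv1 Rintegral_set1 mulr0. Qed.

Lemma RLint_pk b g (h : R -> R) t : 0 < b -> measurable_fun [set: R] h ->
  (forall x, 0 < x < t -> g x = h x) -> (forall x, x <= 0 -> h x = 0) ->
  RLint b g t = (Gamma b)^-1 * \int[mu]_x (pk b (t - x) * h x).
Proof.
move=> b0 mh gh h0; rewrite RLintE//; congr (_ * _).
apply: Rintegral_itv_extend.
- by apply: measurable_funM => //; exact: measurable_pkB.
- by move=> x /andP[x0 xt]; rewrite gh ?x0// pk_gt0E// subr_gt0.
- move=> x; rewrite negb_and -!leNgt => /orP[x0|xt]; first by rewrite h0// mulr0.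
  by rewrite pk_le0 ?mul0r// subr_le0.
Qed.

Lemma RLint_kconv b g w t : 0 < b -> continuous w ->
  (forall x, 0 < x < t -> g x = pk c x * w x) ->
  RLint b g t = (Gamma b)^-1 * kconv b c w t.
Proof.
move=> b0 cw gw; rewrite (@RLint_pk b g (fun x => pk c x * w x))//.
- by rewrite /kconv; congr (_ * _); apply: eq_Rintegral => x _; rewrite mulrA.
- by apply: measurable_funM; [exact: measurable_pk|exact: continuous_measurable_fun].
- by move=> x x0; rewrite pk_le0// mul0r.
Qed.

Let sub_itv t : t <= T -> forall x, 0 < x < t -> 0 < x <= T.
Proof. by move=> tT x /andP[-> xt]; rewrite /= ltW// (lt_le_trans xt). Qed.

(** Only one of the two functions has to be known in C_gam; the other inherits its representation on
    (0,t), and values elsewhere do not matter. *)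
Lemma RLint_eq b f g t : 0 < b -> t <= T -> Cgamma T gam f ->
  (forall x, 0 < x < t -> f x = g x) -> RLint b f t = RLint b g t.
Proof.
move=> b0 tT /CgammaP[w [M [cw wM fE]]] fg.
rewrite (@RLint_kconv b f w)//; last by move=> x xt; apply: fE; exact: sub_itv xt.
rewrite (@RLint_kconv b g w)// => x xt.
by rewrite -fg// fE//; exact: sub_itv xt.
Qed.

(** This is [kconv_scale] read for I^b: it behaves like t^(b-gam) times a continuous function.
    Membership in C_gam, continuity for b > gam and differentiability at 0 are all read off this
    form. *)
Lemma RLint_rep b g : 0 < b -> Cgamma T gam g ->
  exists2 u, continuous u & forall t, 0 <= t <= T -> RLint b g t = pk (b + c) t * u t.
Proof.
move=> b0 /CgammaP[w [M [cw wM gE]]].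
exists (fun t => (Gamma b)^-1 * kconv b c (fun x => w (t * x)) 1).
  by move=> t; apply: cvgMr; apply: continuous_kconv_scale => //; exact: wM.
move=> t /andP[t0 tT]; rewrite (@RLint_kconv b g w)//; last first.
  by move=> x xt; apply: gE; exact: sub_itv xt.
rewrite (kconv_scale _ _ _ _ M)//; first by rewrite mulrCA.
exact: continuous_measurable_fun.
Qed.

Lemma RLint_Cgamma b g : 0 < b -> Cgamma T gam g -> Cgamma T gam (RLint b g).
Proof.
move=> b0 /(RLint_rep b0)[u cu uE]; exists (fun t => pk (b + 1) t * u t).
  apply: continuous_subspaceT => x; apply: cvgM; last exact: cu.
  by apply: continuous_pk; rewrite ltrDr.
move=> t /andP[t0 tT]; rewrite uE ?(ltW t0)// mulrA !pk_gt0E// -powRD; last by rewrite (gt_eqF t0) implybT.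
by congr (_ `^ _ * _); rewrite /c; ring.
Qed.

Lemma RLint_continuous_ext b g : gam < b -> Cgamma T gam g ->
  exists2 u, continuous u & forall t, 0 <= t <= T -> RLint b g t = u t.
Proof.
move=> gb cg; have b0 : 0 < b by exact: lt_trans gb.
have [u cu uE] := RLint_rep b0 cg.
exists (fun t => pk (b + c) t * u t) => //.
move=> x; apply: cvgM; last exact: cu.
by apply: continuous_pk; rewrite /c; lra.
Qed.

Lemma RLint_within b g : gam < b -> Cgamma T gam g ->
  {within `[0, T], continuous (RLint b g)}.
Proof.
move=> gb /(RLint_continuous_ext gb)[u cu uE].
apply: (@subspace_eq_continuous _ _ _ u); last exact: continuous_subspaceT.
by move=> x; rewrite inE/= in_itv/= => xT; exact/esym/uE.
Qed.

Lemma RLint_semigroup a b g t : 0 < a -> 0 < b -> Cgamma T gam g -> 0 <= t <= T ->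
  RLint a (RLint b g) t = RLint (a + b) g t.
Proof.
move=> a0 b0 cg; have /CgammaP[w [M [cw wM gE]]] := cg.
move=> /andP[t0 tT]; have mw := continuous_measurable_fun cw.
have convE x : kconv b c w x = pk (b + c) x * kconv b c (fun y => w (x * y)) 1.
  exact: kconv_scale wM.
rewrite (@RLint_kconv (a + b) g w) ?addr_gt0//; last first.
  by move=> x xt; apply: gE; exact: sub_itv xt.
rewrite (@RLint_pk a _ (fun x => (Gamma b)^-1 * kconv b c w x))//; first last.
- by move=> x x0; rewrite convE (pk_le0 _ _ x0) mul0r mulr0.
- move=> x xt; rewrite (@RLint_kconv b g w)// => y /andP[y0 yx]; apply: gE.
  by move: xt => /andP[x0 xt]; rewrite y0 ltW// (lt_le_trans _ tT)// (lt_trans yx).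
- apply: measurable_funM => //; rewrite (funext convE); apply: measurable_funM; first exact: measurable_pk.
  apply: continuous_measurable_fun; exact: continuous_kconv_scale wM.
under eq_Rintegral => x _ do rewrite mulrCA.
have -> : \int[mu]_x ((Gamma b)^-1 * (pk a (t - x) * kconv b c w x)) =
   (Gamma b)^-1 * \int[mu]_x (pk a (t - x) * kconv b c w x).
  rewrite RintegralZl//.
  (* Pulling out 1/Gamma(b) requires integrability. The rescaled factor is bounded only on compact
     sets, so its argument is clamped to [0,T]; beyond T the kernel [pk a (t - x)] is zero. *)
  have E x : pk a (t - x) * kconv b c w x =
     pk a (t - x) * pk (b + c) x * kconv b c (fun y => w ((clamp T x) * y)) 1.
    rewrite convE mulrA; have [x0|x0] := leP x 0.
      by rewrite (pk_le0 (b + c) _ x0) mulr0 !mul0r.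
    have [xT|xT] := leP x T; first by rewrite clamp_id// ltW.
    by rewrite (pk_le0 a) ?mul0r// subr_le0 (le_trans tT)// ltW.
  have ch := continuous_kconv_scale b c w M b0 c0 cw wM.
  have [N hN] := within_continuous_bounded (ltW T0) (continuous_subspaceT ch).
  apply: (@eq_integrable _ _ _ mu setT measurableT (EFin \o (fun x =>
     pk a (t - x) * pk (b + c) x * kconv b c (fun y => w ((clamp T x) * y)) 1))).
    by move=> x _; rewrite /= -E.
  apply: (integrable_kconv _ _ _ _ N) => //; first by rewrite addr_gt0.
    apply: continuous_measurable_fun => x.
    apply: (@continuous_comp _ _ _ (clamp T) (fun t => kconv b c (fun x => w (t * x)) 1)).
      exact: continuous_clamp.
    exact: ch.
  by move=> x; apply: hN; apply: clamp_itv; exact: ltW.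
rewrite (kconv_semigroup _ _ _ _ M)// /beta.
have := Gamma_gt0 _ a0; have := Gamma_gt0 _ b0; have := Gamma_gt0 (a + b) (addr_gt0 a0 b0).
move: (Gamma _) (Gamma a) (Gamma b) (kconv _ _ _ _) => A B C D h1 h2 h3.
by field; rewrite !gt_eqF.
Qed.

Lemma RLintD b f g t : 0 < b -> Cgamma T gam f -> Cgamma T gam g -> t <= T ->
  RLint b (fun s => f s + g s) t = RLint b f t + RLint b g t.
Proof.
move=> b0 /CgammaP[w [M [cw wM fE]]] /CgammaP[w' [M' [cw' wM' gE]]] tT.
rewrite (@RLint_kconv b f w)//; last by move=> x /(sub_itv tT); exact: fE.
rewrite (@RLint_kconv b g w')//; last by move=> x /(sub_itv tT); exact: gE.
rewrite (@RLint_kconv b _ (fun x => w x + w' x))//.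
- rewrite (kconvD _ _ _ _ _ M M')//; [by rewrite mulrDr| |]; exact: continuous_measurable_fun.
- by move=> x; apply: cvgD; [exact: cw|exact: cw'].
- by move=> x /(sub_itv tT) xT; rewrite fE// gE// mulrDr.
Qed.

Lemma RLintZ b f l t : 0 < b -> Cgamma T gam f -> t <= T ->
  RLint b (fun s => l * f s) t = l * RLint b f t.
Proof.
move=> b0 /CgammaP[w [M [cw wM fE]]] tT.
rewrite (@RLint_kconv b f w)//; last by move=> x /(sub_itv tT); exact: fE.
rewrite (@RLint_kconv b _ (fun x => l * w x))//.
- rewrite (kconvZ _ _ _ _ M)//; [by rewrite mulrCA|exact: continuous_measurable_fun].
- by move=> x; apply: cvgMr; exact: cw.
- by move=> x /(sub_itv tT) xT; rewrite fE// mulrCA.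
Qed.

Lemma RLintN b f t : 0 < b -> Cgamma T gam f -> t <= T ->
  RLint b (fun s => - f s) t = - RLint b f t.
Proof.
move=> b0 cf tT; rewrite -mulN1r -RLintZ//; congr RLint.
by apply/funext => s; rewrite mulN1r.
Qed.

Lemma RLintB b f g t : 0 < b -> Cgamma T gam f -> Cgamma T gam g -> t <= T ->
  RLint b (fun s => f s - g s) t = RLint b f t - RLint b g t.
Proof. by move=> b0 cf cg tT; rewrite RLintD// ?RLintN//; exact: CgammaN. Qed.

Lemma RLint0 b t : 0 < b -> RLint b (fun=> 0) t = 0.
Proof.
move=> b0; rewrite RLintE//.
by rewrite (_ : (fun tau => _) = (cst 0)) ?Rintegral_cst// ?mul0r ?mulr0//; apply/funext => s; rewrite mulr0.
Qed.

Lemma RLint_sum b (I : eqType) (r : seq I) (F : I -> R -> R) t : 0 < b ->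
  (forall i, i \in r -> Cgamma T gam (F i)) -> t <= T ->
  RLint b (fun s => \sum_(i <- r) F i s) t = \sum_(i <- r) RLint b (F i) t.
Proof.
move=> b0 + tT; elim: r => [|i r IHr] hF.
  rewrite big_nil (_ : (fun s => _) = fun=> 0) ?RLint0//.
  by apply/funext => s; rewrite big_nil.
rewrite big_cons -IHr; last by move=> j jr; apply: hF; rewrite in_cons jr orbT.
rewrite -RLintD//; first by congr RLint; apply/funext => s; rewrite big_cons.
  by apply: hF; rewrite mem_head.
by apply: Cgamma_sum => j jr; apply: hF; rewrite in_cons jr orbT.
Qed.

Lemma RLint_norm_le b f g t : 0 < b -> Cgamma T gam f -> Cgamma T gam g -> t <= T ->
  (forall x, 0 < x < t -> `|f x| <= g x) -> `|RLint b f t| <= RLint b g t.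
Proof.
move=> b0 /CgammaP[w [M [cw wM fE]]] /CgammaP[w' [M' [cw' wM' gE]]] tT fg.
rewrite (@RLint_kconv b f w)//; last by move=> x /(sub_itv tT); exact: fE.
rewrite (@RLint_kconv b g w')//; last by move=> x /(sub_itv tT); exact: gE.
have G0 : 0 <= (Gamma b)^-1 by rewrite invr_ge0 ltW// Gamma_gt0.
rewrite normrM ger0_norm// ler_wpM2l//.
have i1 : mu.-integrable setT (EFin \o (fun x => pk b (t - x) * pk c x * w x)).
  by apply: (integrable_kconv _ _ _ _ M) => //; exact: continuous_measurable_fun.
have i2 : mu.-integrable setT (EFin \o (fun x => pk b (t - x) * pk c x * w' x)).
  by apply: (integrable_kconv _ _ _ _ M') => //; exact: continuous_measurable_fun.
apply: (le_trans (le_normr_Rintegral _ i1)) => //.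
apply: le_Rintegral => //; first exact: integrable_norm.
move=> x _; have [x0|x0] := leP x 0; first by rewrite (pk_le0 c _ x0) mulr0 !mul0r normr0.
have [xt|xt] := leP t x; first by rewrite (pk_le0 b) ?subr_le0// !mul0r normr0.
have xT : 0 < x < t by rewrite x0.
rewrite -!mulrA normrM ger0_norm ?pk_ge0// ler_wpM2l ?pk_ge0//.
by rewrite -fE ?(sub_itv tT)// -gE ?(sub_itv tT)// fg.
Qed.

(** Inside the integral (t - x)^(b1-b2) <= T^(b1-b2); the quotient of Gamma values only converts the
    normalisations. It reduces all orders to the smallest one. *)
Lemma RLint_order_le b1 b2 f t : 0 < b2 -> b2 <= b1 -> Cgamma T gam f -> t <= T ->
  (forall x, 0 < x <= T -> 0 <= f x) ->
  RLint b1 f t <= T `^ (b1 - b2) * Gamma b2 / Gamma b1 * RLint b2 f t.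
Proof.
move=> b0 b12 /CgammaP[w [M [cw wM fE]]] tT fg.
have b10 : 0 < b1 by exact: lt_le_trans b12.
have mw := continuous_measurable_fun cw.
rewrite (@RLint_kconv b1 f w)//; last by move=> x /(sub_itv tT); exact: fE.
rewrite (@RLint_kconv b2 f w)//; last by move=> x /(sub_itv tT); exact: fE.
have G1 := Gamma_gt0 _ b10; have G2 := Gamma_gt0 _ b0.
rewrite [leRHS](_ : _ = (Gamma b1)^-1 * (T `^ (b1 - b2) * kconv b2 c w t)); last first.
  move: (Gamma b1) (Gamma b2) (kconv b2 _ _ _) (T `^ _) G1 G2 => A B C D hA hB.
  by field; rewrite !gt_eqF.
rewrite ler_wpM2l ?invr_ge0 ?(ltW G1)//.
rewrite -(kconvZ _ _ _ _ M)//.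
apply: le_Rintegral => //; first exact: (integrable_kconv _ _ _ _ M).
  apply: (integrable_kconv _ _ _ _ (T `^ (b1 - b2) * M)) => //.
    exact: measurable_funM.
  by move=> x; rewrite normrM ger0_norm ?powR_ge0// ler_wpM2l// powR_ge0.
move=> x _; have [x0|x0] := leP x 0; first by rewrite (pk_le0 c _ x0) !mulr0 !mul0r.
have [xt|xt] := leP t x; first by rewrite !(pk_le0 _ (t - x)) ?subr_le0// !mul0r.
have xT : 0 < x < t by rewrite x0.
rewrite (_ : pk b2 _ * _ * _ = T `^ (b1 - b2) * pk b2 (t - x) * (pk c x * w x)); last by ring.
rewrite -mulrA ler_wpM2r//.
  by rewrite -fE ?(sub_itv tT)// fg// (sub_itv tT).
rewrite !pk_gt0E ?subr_gt0// (_ : b1 - 1 = (b1 - b2) + (b2 - 1)); last by ring.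
rewrite powRD; last by rewrite (@gt_eqF _ _ (t - x) 0) ?implybT ?subr_gt0.
rewrite ler_wpM2r ?powR_ge0// ge0_ler_powR ?nnegrE ?subr_ge0//.
- exact: ltW.
- exact: ltW.
- by rewrite lerBlDr (le_trans tT)// lerDl ltW.
Qed.

End WeightedSpace.

Lemma RLint_Phi (R : realType) (b p t : R) : 0 < b -> 0 < p -> 0 < t ->
  RLint b (Phi p) t = Phi (b + p) t.
Proof.
move=> b0 p0 t0.
rewrite (@RLint_pk _ b _ (fun x => (Gamma p)^-1 * pk p x))//.
- under eq_Rintegral => x _ do rewrite mulrCA.
  rewrite RintegralZl//; last first.
    have := integrable_conv_pkB b p t 0 b0 p0.
    by apply: eq_integrable => // x _; rewrite /= subr0.
  rewrite /Rintegral conv_pk BeE// -EFinM/= /beta /Phi pk_gt0E//.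
  have := Gamma_gt0 _ b0; have := Gamma_gt0 _ p0; have := Gamma_gt0 (b + p) (addr_gt0 b0 p0).
  move: (Gamma _) (Gamma b) (Gamma p) (t `^ _) => A B C D h1 h2 h3.
  by field; rewrite !gt_eqF.
- by apply: measurable_funM => //; exact: measurable_pk.
- by move=> x /andP[x0 _]; rewrite pk_gt0E// mulrC.
- by move=> x x0; rewrite pk_le0// mulr0.
Qed.

(** * Derivatives relative to [0,T] *)

Section OneSidedDerivative.
Context {R : realType}.
Variable T : R.
Hypothesis T0 : 0 < T.
Implicit Types (f g : R -> R) (t l s : R).

Definition is_der f t l := forall e : R, 0 < e -> exists2 d : R, 0 < d &
  forall s, 0 <= s <= T -> s != t -> `|s - t| < d -> `|diffquot f t s - l| < e.

Lemma is_derP f t l : is_der f t l <-> (diffquot f t @ within `[0, T] t^' --> l).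
Proof.
split=> [h|h].
  apply/cvgrPdist_lt => e e0; have [d d0 hd] := h e e0.
  rewrite /within/= /dnbhs /within/=; apply/nbhs_ballP; exists d => // s /= st sNt sT.
  rewrite /= in_itv/= in sT; rewrite distrC; apply: hd => //.
  by rewrite distrC.
move=> e e0; move/cvgrPdist_lt : h => /(_ e e0).
rewrite /within/= /dnbhs /within/= => /nbhs_ballP[d /= d0 hd].
exists d => // s sT sNt st; rewrite distrC; apply: hd => //.
by rewrite /ball/= distrC.
Qed.

(** Since T > 0, every point of [0,T] is an accumulation point, approached from the right when t < T
    and from the left at T. Without this the limit defining [derive_on] would not be determined. *)
Lemma within_dnbhs_proper t : 0 <= t <= T -> ProperFilter (within `[0, T] t^').
Proof.
move=> /andP[t0 tT].
apply: Build_ProperFilter_ex => P.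
rewrite /within/= /dnbhs /within/= => /nbhs_ballP[d /= d0 hd].
have [tT'|Tt] := ltP t T.
  pose s := t + Num.min (d / 2) (T - t).
  have m0 : 0 < Num.min (d / 2) (T - t) by rewrite lt_min subr_gt0 tT' divr_gt0.
  have m1 : Num.min (d / 2) (T - t) <= d / 2 by rewrite ge_min lexx.
  have m2 : Num.min (d / 2) (T - t) <= T - t by rewrite ge_min lexx orbT.
  exists s; apply: hd; rewrite /s.
  - by rewrite /ball/= opprD addNKr normrN gtr0_norm//; lra.
  - by rewrite gt_eqF// ltrDl.
  - by rewrite /= in_itv/=; apply/andP; split; lra.
have tE : t = T by apply/eqP; rewrite eq_le tT.
pose s := t - Num.min (d / 2) T.
have m0 : 0 < Num.min (d / 2) T by rewrite lt_min T0 divr_gt0.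
have m1 : Num.min (d / 2) T <= d / 2 by rewrite ge_min lexx.
have m2 : Num.min (d / 2) T <= T by rewrite ge_min lexx orbT.
exists s; apply: hd; rewrite /s.
- by rewrite /ball/= opprB addrC subrK gtr0_norm//; lra.
- by rewrite lt_eqF// gtrBl.
- by rewrite /= in_itv/=; apply/andP; split; lra.
Qed.

Lemma is_der_derivable f t l : is_der f t l -> derivable_on T f t.
Proof. by move=> /is_derP h; apply/cvg_ex; exists l. Qed.

Lemma is_der_derive_on f t l : 0 <= t <= T -> is_der f t l -> derive_on T f t = l.
Proof.
move=> tT /is_derP h; apply: cvg_lim => //.
exact: within_dnbhs_proper.
Qed.

Lemma derivable_is_der f t : derivable_on T f t -> is_der f t (derive_on T f t).
Proof. by move=> h; apply/is_derP; exact: h. Qed.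

Lemma is_deriveP f t l : is_derive t 1 f l <->
  (forall e : R, 0 < e -> exists2 d : R, 0 < d &
    forall s, s != t -> `|s - t| < d -> `|diffquot f t s - l| < e).
Proof.
have E h : h != 0 -> h^-1 *: (f (h *: 1 + t) - f t) = diffquot f t (t + h).
  move=> h0; rewrite /diffquot (_ : h *: 1 = h); last by rewrite /GRing.scale/= mulr1.
  by rewrite [t + h]addrC addrK mulrC.
split=> [[dv <-] e e0|h].
  move/cvgrPdist_lt : dv => /(_ e e0).
  rewrite /dnbhs /within/= => /nbhs_ballP[d /= d0 hd].
  exists d => // s sNt st; rewrite distrC.
  have := hd (s - t); rewrite /ball/= sub0r normrN => /(_ st).
  rewrite subr_eq0 => /(_ sNt); rewrite E ?subr_eq0//.
  by rewrite [t + _]addrC subrK.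
have c : h0^-1 *: (f (h0 *: 1 + t) - f t) @[h0 --> 0^'] --> l.
  apply/cvgrPdist_lt => e e0; have [d d0 hd] := h e e0.
  rewrite /dnbhs /within/=; apply/nbhs_ballP; exists d => // x /=.
  rewrite /ball/= sub0r normrN => xd x0; rewrite E// distrC; apply: hd.
    by rewrite -subr_eq0 addrC addKr.
  by rewrite addrC addKr.
have dv : derivable f t 1 by apply/cvg_ex; exists l.
apply: DeriveDef => //; exact: cvg_lim.
Qed.

Lemma is_derive_is_der f t l : is_derive t 1 f l -> is_der f t l.
Proof.
move=> /is_deriveP h e /h[d d0 hd]; exists d => // s _; exact: hd.
Qed.

Lemma is_der_is_derive f t l : 0 < t < T -> is_der f t l -> is_derive t 1 f l.
Proof.
move=> /andP[t0 tT] h; apply/is_deriveP => e /h[d d0 hd].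
exists (Num.min d (Num.min t (T - t))); first by rewrite !lt_min d0 t0 subr_gt0.
move=> s st; rewrite !lt_min => /andP[sd /andP[s1 s2]]; apply: hd => //.
by move: s1 s2; rewrite !ltr_norml => /andP[a1 a2] /andP[a3 a4]; apply/andP; split; lra.
Qed.

(** Open subsets of [0,T] in the relative topology. The cases used are [0,T] and (0,T]; there a
    function may be replaced by a formula before being differentiated. *)
Definition rel_open (D : R -> Prop) := forall t, D t -> 0 <= t <= T /\
  exists2 d : R, 0 < d & forall s, 0 <= s <= T -> `|s - t| < d -> D s.

Lemma rel_open_closed_itv : rel_open (fun t => 0 <= t <= T).
Proof. by move=> t tT; split => //; exists 1. Qed.

Lemma rel_open_lopen_itv : rel_open (fun t => 0 < t <= T).
Proof.
move=> t /andP[t0 tT]; rewrite (ltW t0) tT; split => //; exists t => // s /andP[s0 ->].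
by rewrite ltr_norml => /andP[st _]; rewrite andbT; lra.
Qed.

Lemma is_der_eq (D : R -> Prop) f g t l : rel_open D -> (forall s, D s -> f s = g s) ->
  D t -> is_der f t l -> is_der g t l.
Proof.
move=> oD fg Dt h e /h[d d0 hd]; have [_ [d' d'0 hd']] := oD _ Dt.
exists (Num.min d d'); first by rewrite lt_min d0.
move=> s sT st; rewrite lt_min => /andP[sd sd'].
by have := hd s sT st sd; rewrite /diffquot !fg//; exact: hd'.
Qed.

Lemma is_derD f g t l l' : is_der f t l -> is_der g t l' ->
  is_der (fun s => f s + g s) t (l + l').
Proof.
move=> /is_derP hf /is_derP hg; apply/is_derP.
rewrite (_ : diffquot _ t = diffquot f t \+ diffquot g t).
  exact: (cvgD hf hg).
by apply/funext => s; rewrite /diffquot/= -mulrDl; congr (_ / _); ring.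
Qed.

Lemma is_der_cvg f t l : is_der f t l -> f s @[s --> within `[0, T] t^'] --> f t.
Proof.
move=> /is_derP h.
have c : f t + diffquot f t s * (s - t) @[s --> within `[0, T] t^'] --> f t + l * (t - t).
  apply: cvgD; first exact: cvg_cst.
  apply: cvgM => //; apply: cvgB; last exact: cvg_cst.
  move=> A nA; change (\forall x \near t, x != t -> `[0, T]%classic x -> A x).
  by apply: filterS nA => x Ax _ _.
rewrite subrr mulr0 addr0 in c; apply: cvg_trans c; apply: near_eq_cvg.
change (\forall s \near t, s != t -> `[0, T]%classic s -> f t + diffquot f t s * (s - t) = f s).
apply: (@filterE _ (nbhs t)) => s st _.
by rewrite /diffquot divfK ?subr_eq0//; ring.
Qed.

Lemma is_derM f g t l l' : is_der f t l -> is_der g t l' ->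
  is_der (fun s => f s * g s) t (l * g t + f t * l').
Proof.
move=> hf hg; have cg := is_der_cvg hg; apply/is_derP.
rewrite (_ : diffquot _ t = (fun s => diffquot f t s * g s + f t * diffquot g t s)).
  move: hf hg => /is_derP hf /is_derP hg.
  apply: cvgD; first by apply: cvgM.
  by apply: cvgM => //; exact: cvg_cst.
apply/funext => s; rewrite /diffquot; rewrite mulrAC mulrA -mulrDl; congr (_ / _); ring.
Qed.

Lemma is_der_cst (a : R) t : is_der (fun=> a) t 0.
Proof.
move=> e e0; exists 1 => // s _ _ _; by rewrite /diffquot subrr mul0r subrr normr0.
Qed.

Lemma is_derZ (a : R) f t l : is_der f t l -> is_der (fun s => a * f s) t (a * l).
Proof.
move=> h; have := is_derM (is_der_cst a t) h; by rewrite mul0r add0r.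
Qed.

Lemma is_der_sum (I : eqType) (r : seq I) (F : I -> R -> R) (L : I -> R) t :
  (forall i, i \in r -> is_der (F i) t (L i)) ->
  is_der (fun s => \sum_(i <- r) F i s) t (\sum_(i <- r) L i).
Proof.
elim: r => [|i r IHr] h.
  rewrite big_nil (_ : (fun s => _) = fun=> 0); first exact: is_der_cst.
  by apply/funext => s; rewrite big_nil.
rewrite big_cons (_ : (fun s => _) = fun s => F i s + \sum_(j <- r) F j s).
  apply: is_derD; first by apply: h; rewrite mem_head.
  by apply: IHr => j jr; apply: h; rewrite in_cons jr orbT.
by apply/funext => s; rewrite big_cons.
Qed.

(** Iterated derivatives are iterated limits of total functions, so they are identified by
    exhibiting a tower F in which each level is proved to be the derivative of the previous one. *)
Lemma deriven_onE (D : R -> Prop) f (F : nat -> R -> R) n : rel_open D ->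
  (forall t, D t -> f t = F 0%N t) ->
  (forall k t, (k < n)%N -> D t -> is_der (F k) t (F k.+1 t)) ->
  forall k t, (k <= n)%N -> D t -> deriven_on T k f t = F k t.
Proof.
move=> oD fF dF; elim=> [|k IHk] t kn Dt; first exact: fF.
rewrite /deriven_on iterS; apply: is_der_derive_on; first by have [] := oD _ Dt.
apply: (is_der_eq oD _ Dt (dF k t kn Dt)) => s Ds.
by rewrite -IHk// ltnW.
Qed.

Lemma derivablen_onE (D : R -> Prop) f (F : nat -> R -> R) n : rel_open D ->
  (forall t, D t -> f t = F 0%N t) ->
  (forall k t, (k < n)%N -> D t -> is_der (F k) t (F k.+1 t)) ->
  forall t, D t -> derivablen_on T n f t.
Proof.
move=> oD fF dF t Dt k kn; apply: (@is_der_derivable _ _ (F k.+1 t)).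
apply: (is_der_eq oD _ Dt (dF k t kn Dt)) => s Ds.
by rewrite (deriven_onE oD fF dF)// ltnW.
Qed.

End OneSidedDerivative.

(** * Fundamental theorem of calculus for functions singular at 0 *)

Section FundamentalTheorem.
Context {R : realType}.
Variables (T gam : R).
Hypotheses (T0 : 0 < T) (gam01 : 0 < gam < 1).
Notation mu := (@lebesgue_measure R).
Implicit Types (f g v w u : R -> R) (p q t : R).
Let c := 1 - gam.
Let c0 : 0 < c. Proof. by rewrite subr_gt0; case/andP: gam01. Qed.
Let gam0 : 0 < gam. Proof. by case/andP: gam01. Qed.
Let gam1 : gam < 1. Proof. by case/andP: gam01. Qed.

Lemma RLint1_is_der g t : Cgamma T gam g -> 0 < t <= T -> is_der T (RLint 1 g) t (g t).
Proof.
move=> /(CgammaP gam T0)[w [M [cw wM gE]]] tT; have /andP[t0 tT'] := tT.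
pose g' x := pk c x * w x.
pose F x := \int[mu]_(s in `[0, x]) g' s.
have FE x : 0 < x <= T -> F x = RLint 1 g x.
  move=> /andP[x0 xT].
  rewrite (@RLint_pk _ 1 g g')//.
  - rewrite Gamma1 invr1 mul1r; apply: Rintegral_itv_extend.
    + apply: measurable_funM; first exact: measurable_pkB.
      apply: measurable_funM; [exact: measurable_pk|exact: continuous_measurable_fun].
    + by move=> y /andP[y0 yx]; rewrite pk_gt0E ?subr_gt0// subrr powRr0 mul1r.
    + move=> y; rewrite negb_and -!leNgt => /orP[y0|yx].
        by rewrite /g' (pk_le0 c _ y0) mul0r mulr0.
      by rewrite pk_le0 ?mul0r// subr_le0.
  - by apply: measurable_funM; [exact: measurable_pk|exact: continuous_measurable_fun].
  - by move=> y /andP[y0 yx]; rewrite gE// y0/= ltW// (lt_le_trans yx).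
  - by move=> y y0; rewrite /g' pk_le0// mul0r.
(* Going up to T + 1 makes t = T an interior point. This is possible because w is defined and
   bounded beyond T; on this interval [pk 1 (T + 2 - x)] is 1. *)
have ig : mu.-integrable `[0, T + 1] (EFin \o g').
  apply: (@eq_integrable _ _ _ mu _ _ (EFin \o (fun x => pk 1 (T + 2 - x) * pk c x * w x))) => //.
    move=> x; rewrite inE/= in_itv/= => /andP[x0 xT]; congr EFin.
    rewrite pk_gt0E ?subrr ?powRr0 ?mul1r//; lra.
  apply: (@integrableS _ _ _ mu setT) => //.
  by apply: (integrable_kconv _ _ _ _ M) => //; exact: continuous_measurable_fun.
have cg : {for t, continuous g'}.
  apply: cvgM; last exact: cw.
  have cp : {for t, continuous (fun y => y `^ (c - 1))}.
    apply: differentiable_continuous; apply/derivable1_diffP.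
    by apply: derivable_powR; rewrite in_itv/= andbT.
  rewrite pk_gt0E//; apply: cvg_trans cp; apply: near_eq_cvg; near=> y.
  by rewrite pk_gt0E//; near: y; exact: lt_nbhsr.
have tT1 : t < T + 1 by lra.
have [dF FE'] := continuous_FTC1_closed tT1 ig t0 cg.
have isd : is_derive t 1 F (g t).
  have -> : g t = g' t by exact: gE.
  by rewrite -FE' derive1E; exact: DeriveDef.
exact: (is_der_eq (@rel_open_lopen_itv _ T) FE tT (is_derive_is_der T isd)).
Unshelve. all: by end_near. Qed.

Lemma RLint_is_der v q t : 0 < q -> Cgamma T gam v -> 0 < t <= T ->
  is_der T (RLint (1 + q) v) t (RLint q v t).
Proof.
move=> q0 cv tT.
have h := RLint1_is_der (RLint_Cgamma T0 gam01 q0 cv) tT.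
apply: (is_der_eq (@rel_open_lopen_itv _ T) _ tT h) => s /andP[s0 sT].
by rewrite (RLint_semigroup T0 gam01)// (ltW s0).
Qed.

(** The new point is t = 0: by [RLint_rep] the difference quotient is s^(q-gam) u(s), which tends to
    0 = I^q v(0) because q > gam. *)
Lemma RLint_is_der_closed v q t : gam < q -> Cgamma T gam v -> 0 <= t <= T ->
  is_der T (RLint (1 + q) v) t (RLint q v t).
Proof.
move=> q0 cv /andP[t0 tT]; have q0' : 0 < q by exact: lt_trans q0.
have q10 : 0 < 1 + q by rewrite addr_gt0.
move: t0; rewrite le_eqVlt => /predU1P[<-|t0]; last by apply: RLint_is_der => //; rewrite t0.
have [u cu uE] := RLint_rep T0 gam01 q10 cv.
rewrite RLint_t0//.
have cp : pk (q + c) s * u s @[s --> 0] --> pk (q + c) 0 * u 0.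
  by apply: cvgM; [apply: continuous_pk; rewrite /c; lra|exact: cu].
rewrite pk_le0// mul0r in cp.
move=> e e0; move/cvgrPdist_lt : cp => /(_ e e0) /nbhs_ballP[d /= d0 hd].
exists d => // s sT s0; rewrite subr0 => sd.
have := hd s; rewrite /ball/= !sub0r !normrN => /(_ sd).
rewrite /diffquot subr0 RLint_t0// !subr0 uE//.
have s0' : 0 < s by move: sT => /andP[]; rewrite le_eqVlt eq_sym (negbTE s0).
suff -> : pk (1 + q + c) s * u s / s = pk (q + c) s * u s by [].
rewrite mulrAC; congr (_ * _).
rewrite !pk_gt0E// (_ : 1 + q + c - 1 = (q + c - 1) + 1); last by ring.
by rewrite powRD ?(gt_eqF s0') ?implybT// powRr1 ?ltW// mulfK.
Qed.

(** The mean value theorem applied to F - I^1 g, which is continuous up to 0 and has zero derivative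
    inside. No derivative at 0 is asked for, so g may blow up there. *)
Lemma is_der_RLint1_unique F g : {within `[0, T], continuous F} -> Cgamma T gam g ->
  (forall t, 0 < t <= T -> is_der T F t (g t)) -> F 0 = 0 ->
  forall t, 0 <= t <= T -> F t = RLint 1 g t.
Proof.
move=> cF cg dF F0 t /andP[t0 tT].
move: t0; rewrite le_eqVlt => /predU1P[<-|t0]; first by rewrite RLint_t0.
pose D s := F s + (-1) * RLint 1 g s.
have cD : {within `[0, T], continuous D}.
  move=> x; apply: cvgD; first exact: cF.
  by apply: cvgMr; apply: (RLint_within T0 gam01).
have dD s : 0 < s <= T -> is_der T D s 0.
  move=> sT; rewrite (_ : 0 = g s + (-1) * g s); last by ring.
  exact: (is_derD (dF s sT) (is_derZ (-1) (RLint1_is_der cg sT))).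
have dD' s : s \in `]0, t[ -> is_derive s 1 D ((fun=> 0) s).
  rewrite in_itv/= => /andP[s0 st]; have sT : s < T by exact: lt_le_trans tT.
  by apply: (@is_der_is_derive _ T); [rewrite s0|apply: dD; rewrite s0 ltW].
have cD' : {within `[0, t], continuous D}.
  by apply: continuous_subspaceW cD; apply: subset_itvl; rewrite bnd_simp.
have [x _] := MVT t0 dD' cD'.
rewrite mul0r {1}/D => /eqP; rewrite subr_eq0 /D F0 RLint_t0// mulr0 addr0 => /eqP.
by rewrite mulN1r => /eqP; rewrite subr_eq0 => /eqP.
Qed.

End FundamentalTheorem.

(** * Caputo derivatives of Taylor forms *)

Section Monomials.
Context {R : realType}.
Implicit Types (T t : R) (j k n : nat).

(* The k-th derivative of t^j/j!. *)
Definition mono j k t : R := if (k <= j)%N then t ^+ (j - k) / (j - k)`!%:R else 0.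

Lemma is_der_id T t : is_der T id t 1.
Proof.
move=> e e0; exists 1 => // s _ st _.
by rewrite /diffquot divff ?subr_eq0// subrr normr0.
Qed.

Lemma is_derX T n t : is_der T (fun s => s ^+ n.+1) t (n.+1%:R * t ^+ n).
Proof.
elim: n => [|n IHn]; first by rewrite expr0 mulr1; exact: is_der_id.
have := is_derM (is_der_id T t) IHn.
rewrite (_ : 1 * t ^+ n.+1 + _ = n.+2%:R * t ^+ n.+1); last first.
  by rewrite -[n.+2]addn1 natrD /= exprS; ring.
by rewrite (_ : (fun s => id s * s ^+ n.+1) = fun s => s ^+ n.+2)//; apply/funext => s; rewrite -exprS.
Qed.

Lemma mono_is_der T j k t : is_der T (mono j k) t (mono j k.+1 t).
Proof.
rewrite /mono; have [kj|kj|kj] := ltngtP k j.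
- have E : (j - k = (j - k.+1).+1)%N by rewrite -subSn.
  rewrite E; set p := (j - k.+1)%N.
  have := is_derZ (p.+1`!%:R)^-1 (is_derX T p t).
  rewrite (_ : _ * (_ * _) = t ^+ p / p`!%:R); last first.
    rewrite factS natrM; have p0 : (p`!%:R : R) != 0 by rewrite pnatr_eq0 -lt0n fact_gt0.
    have p1 : (p.+1%:R : R) != 0 by rewrite pnatr_eq0.
    by move: (t ^+ p) (p`!%:R) (p.+1%:R) p0 p1 => A B C h1 h2; field; rewrite h1 h2.
  by rewrite (_ : (fun s => _ * _) = fun s => s ^+ p.+1 / p.+1`!%:R)//; apply/funext => s; rewrite mulrC.
- exact: is_der_cst.
- rewrite kj subnn.
  rewrite (_ : (fun t => _) = fun=> 1%R); first exact: is_der_cst.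
  by apply/funext => s; rewrite expr0 fact0 divr1.
Qed.

Lemma mono_at0 j k : mono j k 0 = (k == j)%:R.
Proof.
rewrite /mono; case: (ltngtP k j) => kj//.
  by rewrite expr0n subn_eq0 leqNgt kj/= mul0r.
by rewrite kj subnn expr0 fact0 divr1.
Qed.

Lemma mono_continuous j k : continuous (mono j k).
Proof.
rewrite /mono; case: (k <= j)%N => t; last exact: cvg_cst.
by apply: cvgMl; exact: exprn_continuous.
Qed.

Lemma mono_Phi j t : 0 <= t -> mono j 0 t = Phi j.+1%:R t.
Proof.
move=> t0; rewrite /mono leq0n subn0 /Phi Gamma_nat -natr1 addrK powR_mulrn//.
Qed.

End Monomials.

Lemma RLint_order0 (R : realType) (f : R -> R) (t : R) : RLint 0 f t = f t.
Proof. by rewrite /RLint eqxx. Qed.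

Lemma PhiE (R : realType) (b t : R) : Phi b t = t `^ (b - 1) / Gamma b.
Proof. by []. Qed.

Local Opaque RLint Phi.

Section TaylorForm.
Context {R : realType}.
Variables (T gam : R) (n j : nat) (z om : R -> R).
Hypotheses (T0 : 0 < T) (gam01 : 0 < gam < 1) (jn : (j < n)%N).
Hypothesis com : Cgamma T gam om.
Hypothesis zE : forall t, 0 <= t <= T -> z t = mono j 0 t + RLint n%:R om t.
Implicit Types (t : R) (k N : nat).
Let gam0 : 0 < gam. Proof. by case/andP: gam01. Qed.
Let gam1 : gam < 1. Proof. by case/andP: gam01. Qed.

Let F k t := mono j k t + RLint (n%:R - k%:R) om t.

Let subn_split k : (k < n)%N -> (n%:R - k%:R : R) = 1 + (n%:R - k.+1%:R).
Proof. by move=> _; rewrite -[k.+1%:R]natr1; ring. Qed.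

Let subn_ge1 k : (k < n)%N -> 1 <= (n%:R - k%:R : R).
Proof. by move=> kn; rewrite lerBrDr nat1r ler_nat. Qed.

Let F_is_der k t : (k.+1 < n)%N -> 0 <= t <= T -> is_der T (F k) t (F k.+1 t).
Proof.
move=> kn tT; apply: is_derD; first exact: mono_is_der.
rewrite subn_split ?(ltnW kn)//; apply: (RLint_is_der_closed T0 gam01) => //.
exact: lt_le_trans (subn_ge1 kn).
Qed.

Let F0 t : 0 <= t <= T -> z t = F 0%N t.
Proof.
move=> tT; rewrite (zE tT) /F.
by have -> : n%:R - 0%:R = n%:R :> R by rewrite subr0.
Qed.

Lemma taylor_deriven k t : (k < n)%N -> 0 <= t <= T ->
  deriven_on T k z t = mono j k t + RLint (n%:R - k%:R) om t.
Proof.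
(* On the closed interval the tower stops at n - 1: each integral that results from a
   differentiation still has order at least 1, hence above gam. *)
move=> kn tT; apply: (@deriven_onE _ T T0 _ z F n.-1 (@rel_open_closed_itv _ T) F0) => //.
  by move=> k' t' kn'; apply: F_is_der; rewrite -ltn_predRL.
by rewrite -ltnS prednK// (leq_ltn_trans _ kn).
Qed.

(** The tower on (0,T], with one more level: the n-th derivative is om alone, because j < n makes
    the monomial disappear. *)
Let G k t := if (k < n)%N then F k t else om t.

Let n0 : (0 < n)%N. Proof. exact: leq_ltn_trans jn. Qed.

Let G_is_der k t : (k < n)%N -> 0 < t <= T -> is_der T (G k) t (G k.+1 t).
Proof.
move=> kn tT; rewrite /G kn; have [kn1|] := ltnP k.+1 n.
  by apply: F_is_der => //; case/andP: tT => t0 ->; rewrite ltW.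
move=> nk; have nE : n = k.+1 by apply/eqP; rewrite eqn_leq nk kn.
rewrite -[om t]add0r (_ : 0 = mono j k.+1 t); last by rewrite /mono -nE leqNgt jn.
apply: is_derD; first exact: mono_is_der.
rewrite (_ : n%:R - k%:R = 1 :> R); last by rewrite nE -natr1; ring.
exact: (RLint1_is_der T0 gam01).
Qed.

Lemma taylor_deriven_top t : 0 < t <= T -> deriven_on T n z t = om t.
Proof.
move=> tT; rewrite (@deriven_onE _ T T0 _ z G n (@rel_open_lopen_itv _ T) _ G_is_der)//.
  by rewrite /G ltnn.
by move=> s /andP[s0 sT]; rewrite /G n0 F0// ltW.
Qed.

Let F_continuous k : (k < n)%N -> {within `[0, T], continuous (F k)}.
Proof.
move=> kn x; apply: cvgD; first exact: (continuous_subspaceT (@mono_continuous R j k)).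
apply: (RLint_within T0 gam01) => //; exact: lt_le_trans (subn_ge1 kn).
Qed.

Lemma taylor_Cngamma : Cngamma T n gam z.
Proof.
split.
- apply: (@derivablen_onE _ T T0 _ z F n.-1 (@rel_open_closed_itv _ T) F0).
  by move=> k' t' kn'; apply: F_is_der; rewrite -ltn_predRL.
- move=> k kn; apply: (@subspace_eq_continuous _ _ _ (F k)); last exact: F_continuous.
  by move=> x; rewrite inE/= in_itv/= => xT; exact/esym/taylor_deriven.
- apply: (@derivablen_onE _ T T0 _ z G n (@rel_open_lopen_itv _ T) _ G_is_der).
  by move=> s /andP[s0 sT]; rewrite /G n0 F0// ltW.
- by apply: Cgamma_eq com => t tT; rewrite taylor_deriven_top.
Qed.

Lemma taylor_init k : (k < n)%N -> deriven_on T k z 0 = (k == j)%:R.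
Proof.
move=> kn; rewrite taylor_deriven// ?lexx ?ltW//.
rewrite mono_at0 RLint_t0 ?addr0//; exact: lt_le_trans (subn_ge1 kn).
Qed.

Lemma taylor_limit k : (k < n)%N -> deriven_on T k z t @[t --> 0^'+] --> ((k == j)%:R : R).
Proof.
move=> kn; rewrite -(taylor_init kn).
have [_ /(_ k kn) cz _ _] := taylor_Cngamma.
by have [] := (continuous_within_itvP _ T0).1 cz.
Qed.

Section CaputoForm.
Variables (N : nat) (al : R).
Hypotheses (alN : nceil al = N) (alN' : N%:R - 1 < al <= N%:R).
Hypotheses (Nn : (N <= n)%N) (aln : al < n%:R).

Let theta : R := (N <= j)%N%:R.

(** By the initial data the Taylor polynomial of order N contains the single monomial t^j/j! when j
    < N and is zero otherwise; [theta] records whether the monomial survives. *)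
Let rem_E t : 0 < t <= T ->
  taylor_remainder T N z t = theta * Phi j.+1%:R t + RLint n%:R om t.
Proof.
move=> /andP[t0 tT]; rewrite /taylor_remainder zE ?(ltW t0)// addrAC; congr (_ + _).
rewrite -mono_Phi ?(ltW t0)//.
rewrite (eq_big_nat _ _ (F2 := fun k => (k == j)%:R / k`!%:R * t ^+ k)); last first.
  by move=> k /andP[_ kN]; rewrite taylor_init// (leq_trans kN).
rewrite /theta; have [Nj|jN] := leqP N j.
  rewrite mul1r big_nat_cond big1 ?subr0// => k /andP[/andP[_ kN] _].
  by rewrite ltn_eqF ?mul0r// (leq_trans kN).
rewrite mul0r (bigD1_seq j) ?mem_index_iota ?iota_uniq//=.
rewrite eqxx big1 ?addr0; last by move=> k /negbTE ->; rewrite !mul0r.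
by rewrite /mono leq0n subn0 mul1r mulrC subrr.
Qed.

(** I^(N-al) raises both indices by N - al, and each of the k derivatives lowers them by 1; k = N
    gives the Caputo derivative. *)
Let H k t := theta * Phi (j.+1%:R + N%:R - al - k%:R) t + RLint (n%:R + N%:R - al - k%:R) om t.

Let al_bounds : N%:R - 1 < al /\ al <= N%:R. Proof. by case/andP: alN'. Qed.

Let n_pos : 0 < n%:R :> R. Proof. by rewrite ltr0n. Qed.

Let theta_le : theta = 0 \/ (theta = 1 /\ N%:R <= j%:R :> R).
Proof. by rewrite /theta; case: leqP => h; [right; rewrite ler_nat|left]. Qed.

Let H0 t : 0 < t <= T -> RLint (N%:R - al) (taylor_remainder T N z) t = H 0%N t.
Proof.
move=> tT; have /andP[t0 tT'] := tT; have [h1 h2] := al_bounds.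
(* For integer al the integral has order 0, where [RLint] is the identity by definition and the
   kernel lemmas do not apply. *)
have [E|NE] := eqVneq (N%:R - al) 0.
  have e1 : j.+1%:R + N%:R - al - 0%:R = j.+1%:R by rewrite subr0 -addrA E addr0.
  have e2 : n%:R + N%:R - al - 0%:R = n%:R by rewrite subr0 -addrA E addr0.
  by rewrite E RLint_order0 (rem_E tT) /H e1 e2.
have q0 : 0 < N%:R - al by rewrite lt_neqAle eq_sym NE subr_ge0.
have cP : Cgamma T gam (Phi j.+1%:R).
  by apply: Phi_Cgamma => //; rewrite -natr1; have j0 := ler0n R j; have g0 := gam0; lra.
have c1 : Cgamma T gam (fun s => theta * Phi j.+1%:R s) by exact: CgammaZ.
have c2 : Cgamma T gam (RLint n%:R om) by exact: RLint_Cgamma.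
transitivity (RLint (N%:R - al) (fun s => theta * Phi j.+1%:R s + RLint n%:R om s) t).
  apply/esym; apply: (RLint_eq (T := T) (gam := gam)) => //; first exact: CgammaD.
  by move=> x /andP[x0 xt]; rewrite rem_E// x0/= ltW// (lt_le_trans xt).
rewrite (RLintD T0 gam01 q0 c1 c2 tT').
rewrite (RLintZ T0 gam01 _ q0 cP tT').
have tT0 : 0 <= t <= T by rewrite (ltW t0).
have j1 : 0 < j.+1%:R :> R by rewrite ltr0n.
rewrite (RLint_semigroup T0 gam01 q0 n_pos com tT0) (RLint_Phi q0 j1 t0) /H.
have e1 : N%:R - al + j.+1%:R = j.+1%:R + N%:R - al - 0%:R by ring.
have e2 : N%:R - al + n%:R = n%:R + N%:R - al - 0%:R by ring.
by rewrite e1 e2.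
Qed.

Let H_is_der k t : (k < N)%N -> 0 < t <= T -> is_der T (H k) t (H k.+1 t).
Proof.
move=> kN tT; have [h1 h2] := al_bounds.
have kN' : k%:R + 1 <= N%:R :> R by rewrite natr1 ler_nat.
apply: is_derD; last first.
  rewrite (_ : n%:R + N%:R - al - k%:R = 1 + (n%:R + N%:R - al - k.+1%:R)); last first.
    by rewrite -natr1; ring.
  have e : k.+1%:R = k%:R + 1 :> R by rewrite natr1.
  by apply: (RLint_is_der T0 gam01) => //; rewrite e; have aln_ := aln; lra.
have [->|[-> Nj]] := theta_le.
  rewrite mul0r (_ : (fun s => _) = fun=> 0); first exact: is_der_cst.
  by apply/funext => s; exact: mul0r.
apply: is_derZ.
(* From k < N <= j and al <= N the index of Phi stays at least 1, so its derivative never leaves the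
   range where [RLint_Phi] applies. *)
have p1 : 1 <= j.+1%:R + N%:R - al - k.+1%:R :> R by rewrite -!natr1; lra.
have cp : Cgamma T gam (Phi (j.+1%:R + N%:R - al - k.+1%:R)).
  by apply: Phi_Cgamma => //; have g0 := gam0; lra.
apply: (is_der_eq (@rel_open_lopen_itv _ T) _ tT (RLint1_is_der T0 gam01 cp tT)).
move=> s /andP[s0 sT]; rewrite (RLint_Phi _ (lt_le_trans ltr01 p1) s0); last exact: ltr01.
have -> : 1 + (j.+1%:R + N%:R - al - k.+1%:R) = j.+1%:R + N%:R - al - k%:R.
  by rewrite -[k.+1%:R]natr1; ring.
by [].
Qed.

Lemma taylor_caputo_derivable t : 0 < t <= T -> caputo_derivable T al z t.
Proof.
move=> tT; rewrite /caputo_derivable /RLderivable alN.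
exact: (derivablen_onE T0 (@rel_open_lopen_itv _ T) H0 H_is_der tT).
Qed.

Lemma taylor_caputo t : 0 < t <= T ->
  caputo T al z t = theta * Phi (j.+1%:R - al) t + RLint (n%:R - al) om t.
Proof.
move=> tT; rewrite /caputo /RLderive alN.
rewrite (deriven_onE T0 (@rel_open_lopen_itv _ T) H0 H_is_der (leqnn N) tT).
rewrite /H (_ : j.+1%:R + N%:R - al - N%:R = j.+1%:R - al); last by ring.
by rewrite (_ : n%:R + N%:R - al - N%:R = n%:R - al); last by ring.
Qed.

End CaputoForm.

End TaylorForm.

(** The converse of the Taylor form computations, needed for uniqueness. The n-th derivative is
    integrated n times; continuity at 0 turns the prescribed limits into the integration
    constants. *)
Lemma taylor_form (R : realType) (T gam : R) (n j : nat) (z : R -> R) :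
  0 < T -> 0 < gam < 1 -> (j < n)%N -> Cngamma T n gam z ->
  (forall k, (k < n)%N -> deriven_on T k z t @[t --> 0^'+] --> ((k == j)%:R : R)) ->
  Cgamma T gam (deriven_on T n z) /\
  forall t, 0 <= t <= T -> z t = mono j 0 t + RLint n%:R (deriven_on T n z) t.
Proof.
move=> T0 gam01 jn [d1 cz d2 com] lim0; split => //.
have gam1 : gam < 1 by case/andP: gam01.
set om := deriven_on T n z in com *.
have init k : (k < n)%N -> deriven_on T k z 0 = (k == j)%:R.
  move=> kn; have [_ h _] := (continuous_within_itvP _ T0).1 (cz k kn).
  exact: (cvg_unique _ h (lim0 k kn)).
(* Induction on the number p + 1 of integrations, starting from the derivative of order n - 1. *)
suff H p : (p < n)%N -> forall t, 0 <= t <= T ->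
    deriven_on T (n - p.+1) z t = mono j (n - p.+1) t + RLint p.+1%:R om t.
  move=> t tT; have n0 : (0 < n)%N by exact: leq_ltn_trans jn.
  by have := H n.-1; rewrite prednK// subnn; apply; rewrite // ltn_predL.
elim: p => [|p IHp] pn t tT.
  rewrite subn1; have n1n : (n.-1 < n)%N by rewrite prednK// (leq_ltn_trans _ jn).
  pose D s := deriven_on T n.-1 z s + (-1) * mono j n.-1 s.
  have cD : {within `[0, T], continuous D}.
    move=> x; apply: cvgD; first exact: cz.
    by apply: cvgMr; exact: (continuous_subspaceT (@mono_continuous R j n.-1)).
  have dD s : 0 < s <= T -> is_der T D s (om s).
    move=> sT; rewrite (_ : om s = om s + (-1) * mono j n.-1.+1 s); last first.
      by rewrite prednK ?(leq_ltn_trans _ jn)// /mono leqNgt jn/= mulr0 addr0.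
    apply: is_derD; last by apply: is_derZ; exact: mono_is_der.
    have dE : derive_on T (deriven_on T n.-1 z) = om.
      by rewrite /om; case: (n) (leq_ltn_trans (leq0n j) jn).
    by rewrite -dE; exact: derivable_is_der (d2 s sT _ n1n).
  have D0 : D 0 = 0 by rewrite /D init// mono_at0 mulN1r subrr.
  by rewrite -(is_der_RLint1_unique T0 gam01 cD com dD D0 tT) /D; ring.
have kn : (n - p.+2 < n)%N by rewrite ltn_subrL (leq_ltn_trans _ jn).
have kS : (n - p.+2).+1 = (n - p.+1)%N by rewrite subnSK.
pose D s := deriven_on T (n - p.+2) z s + (-1) * mono j (n - p.+2) s.
have cD : {within `[0, T], continuous D}.
  move=> x; apply: cvgD; first exact: cz.
  by apply: cvgMr; exact: (continuous_subspaceT (@mono_continuous R j _)).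
have p1 : 0 < p.+1%:R :> R by rewrite ltr0n.
have dD s : 0 < s <= T -> is_der T D s (RLint p.+1%:R om s).
  move=> sT; have /andP[s0 sT'] := sT.
  rewrite (_ : RLint p.+1%:R om s = deriven_on T (n - p.+2).+1 z s + (-1) * mono j (n - p.+2).+1 s).
    apply: is_derD; last by apply: is_derZ; exact: mono_is_der.
    exact: (derivable_is_der (d2 s sT _ kn)).
  rewrite kS IHp ?(ltnW pn) ?(ltW s0)//; ring.
have D0 : D 0 = 0 by rewrite /D init// mono_at0 mulN1r subrr.
have := is_der_RLint1_unique T0 gam01 cD (RLint_Cgamma T0 gam01 p1 com) dD D0 tT.
rewrite (RLint_semigroup T0 gam01)// /D nat1r => <-; ring.
Qed.

(** * Geometric estimates *)

Section GeometricConvergence.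
Context {R : realType}.
Implicit Types (K : R).

Lemma half_powS k : 2^-1 ^+ k = 2^-1 ^+ k.+1 + 2^-1 ^+ k.+1 :> R.
Proof. by rewrite exprS; field. Qed.

Lemma half_pow_cvg0 K : K * 2^-1 ^+ n @[n --> \oo] --> 0.
Proof.
rewrite -[X in _ --> X](mulr0 K); apply: cvgMr; apply: cvg_expr.
by rewrite ger0_norm ?invr_ge0// invf_lt1// ltr1n.
Qed.

Lemma geometric_tail (f : nat -> R) K : 0 <= K -> (forall k, `|f k| <= K * 2^-1 ^+ k) ->
  forall N, `|limn (series f) - series f N| <= 2 * K * 2^-1 ^+ N.
Proof.
move=> K0 fK.
(* The exact geometric sum is kept so that the induction on p closes; the subtracted term is dropped
   only in the limit. *)
have tail N p : `|series f (N + p)%N - series f N| <= 2 * K * (2^-1 ^+ N - 2^-1 ^+ (N + p)).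
  elim: p => [|p IHp]; first by rewrite addn0 !subrr normr0 mulr0.
  rewrite addnS /series/= big_nat_recr//= addrAC.
  apply: (le_trans (ler_normD _ _)); apply: (le_trans (lerD IHp (fK _))).
  by rewrite (half_powS (N + p)); set h := _ ^+ (N + p).+1; set h' := _ ^+ N; lra.
have cf : cvgn (series f).
  apply: normed_cvg; apply: (@series_le_cvg _ _ (fun k => K * 2^-1 ^+ k)).
  - by move=> k; exact: normr_ge0.
  - by move=> k; rewrite mulr_ge0// exprn_ge0// invr_ge0.
  - exact: fK.
  - by apply: is_cvg_geometric_series; rewrite ger0_norm ?invr_ge0// invf_lt1// ltr1n.
move=> N.
have c : `|series f (k + N)%N - series f N| @[k --> \oo] --> `|limn (series f) - series f N|.
  apply: cvg_norm; apply: cvgB; last exact: cvg_cst.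
  by rewrite (@cvg_shiftn N _ (series f)); exact: cf.
apply: (cvgr_to_le c); apply: nearW => k; rewrite addnC.
apply: (le_trans (tail N k)); rewrite ler_wpM2l ?mulr_ge0// gerBl exprn_ge0// invr_ge0.
Qed.

(** The Weierstrass test with its rate: the explicit error is needed later to pass the limit through
    integral operators. *)
Lemma geometric_uniform_continuous (w_ : nat -> R -> R) K : 0 <= K ->
  (forall k, continuous (w_ k)) -> (forall k x, `|w_ k x| <= K * 2^-1 ^+ k) ->
  exists2 w : R -> R, continuous w &
    forall x N, `|w x - \sum_(0 <= k < N) w_ k x| <= 2 * K * 2^-1 ^+ N.
Proof.
move=> K0 cw wK; pose w x := limn (series (fun k => w_ k x)).
have wS x N : `|w x - \sum_(0 <= k < N) w_ k x| <= 2 * K * 2^-1 ^+ N.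
  by apply: (geometric_tail K0).
exists w => // x; apply/cvgrPdist_lt => e e0.
have := half_pow_cvg0 (2 * K) => /cvgrPdist_lt /(_ (e / 3)).
rewrite divr_gt0// => /(_ isT)[N _ /(_ N (leqnn N))].
rewrite sub0r normrN ger0_norm ?mulr_ge0 ?exprn_ge0 ?invr_ge0// => hN.
have cS : continuous (fun y => \sum_(0 <= k < N) w_ k y).
  elim: N {hN} => [|N IHN] y.
    rewrite (_ : (fun y => _) = cst 0); first exact: cvg_cst.
    by apply/funext => z; rewrite big_nil.
  rewrite (_ : (fun y => _) = fun y => \sum_(0 <= k < N) w_ k y + w_ N y).
    by apply: cvgD; [exact: IHN|exact: cw].
  by apply/funext => z; rewrite big_nat_recr.
have := cS x => /cvgrPdist_lt /(_ (e / 3)); rewrite divr_gt0// => /(_ isT).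
apply: filterS => y; set Sx := \sum_(0 <= k < N) w_ k x; set Sy := \sum_(0 <= k < N) w_ k y => hS.
have h1 : `|w x - Sx| < e / 3 := le_lt_trans (wS x N) hN.
have h2 : `|w y - Sy| < e / 3 := le_lt_trans (wS y N) hN.
rewrite (_ : w x - w y = (w x - Sx) + (Sx - Sy) - (w y - Sy)); last by ring.
apply: (le_lt_trans (ler_normB _ _)); apply: (le_lt_trans (lerD (ler_normD _ _) (lexx _))).
by lra.
Qed.

Lemma eq0_geometric_le (x K : R) : (forall N, `|x| <= K * 2^-1 ^+ N) -> x = 0.
Proof.
move=> xK; apply/normr0_eq0; apply/eqP; rewrite eq_le normr_ge0 andbT.
by apply: (cvgr_to_ge (half_pow_cvg0 K)); exact: nearW.
Qed.

(** For s < 1 the bound is taken at s + 1, where it is stronger because N >= 1, and Gamma(s+1) = s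
    Gamma(s) <= Gamma(s). *)
Lemma Gamma_ge_powR (N : nat) (s : R) : (0 < N)%N -> 0 < s ->
  N%:R `^ (s - 1) * expR (- N.+1%:R) <= Gamma s.
Proof.
move=> N0 s0; have [s1|s1] := leP 1 s; first exact: Gamma_lower_bound.
have N1 : 1 <= N%:R :> R by rewrite ler1n.
have s11 : 1 <= s + 1 by rewrite lerDr ltW.
apply: (@le_trans _ _ (N%:R `^ (s + 1 - 1) * expR (- N.+1%:R))).
  rewrite ler_wpM2r ?expR_ge0//; apply: ler_powR => //; lra.
apply: (le_trans (Gamma_lower_bound N (s + 1) N0 s11)).
by rewrite GammaS// ler_piMl ?ltW// Gamma_gt0.
Qed.

Lemma Gamma_geometric (X b c : R) : 0 <= X -> 0 < b -> 0 < c ->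
  exists2 K, 0 <= K & forall k : nat, X ^+ k / Gamma (c + k%:R * b) <= K * 2^-1 ^+ k.
Proof.
move=> X0 b0 c0.
(* N is chosen so that N^b >= 2 X. The lower bound for Gamma(c + k b) contains (N^b)^k, so the ratio
   becomes at most 1/2. *)
pose Y := (2 * X + 1) `^ b^-1; pose N := (Num.truncn Y).+1.
have YN : Y <= N%:R by rewrite ltW// -truncn_lt_nat// powR_ge0.
have N0 : (0 < N)%N by [].
have NR0 : 0 < N%:R :> R by rewrite ltr0n.
have XN : 2 * X <= N%:R `^ b.
  apply: (@le_trans _ _ (Y `^ b)); last first.
    by apply: ge0_ler_powR => //; rewrite ?nnegrE ?powR_ge0 ?ltW.
  rewrite /Y -powRrM mulVf ?gt_eqF// powRr1; lra.
pose E : R := expR (- N.+1%:R).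
exists ((N%:R `^ (c - 1) * E)^-1).
  by rewrite invr_ge0 mulr_ge0 ?powR_ge0// expR_ge0.
move=> k; have s0 : 0 < c + k%:R * b by rewrite ltr_wpDr// mulr_ge0// ltW.
have G := Gamma_ge_powR N0 s0.
have D0 : 0 < N%:R `^ (c + k%:R * b - 1) * E by rewrite mulr_gt0 ?powR_gt0 ?expR_gt0.
apply: (@le_trans _ _ (X ^+ k / (N%:R `^ (c + k%:R * b - 1) * E))).
  by rewrite ler_wpM2l ?exprn_ge0// lef_pV2 ?posrE// (lt_le_trans D0).
rewrite (_ : c + k%:R * b - 1 = (c - 1) + b * k%:R); last by ring.
rewrite powRD ?(gt_eqF NR0) ?implybT// powRrM powR_mulrn ?powR_ge0//.
have A0 : 0 < N%:R `^ (c - 1) :> R by rewrite powR_gt0.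
have E0 : 0 < E by exact: expR_gt0.
have B0 : 0 < N%:R `^ b :> R by rewrite powR_gt0.
rewrite (_ : _ / _ = (N%:R `^ (c - 1) * E)^-1 * (X / N%:R `^ b) ^+ k); last first.
  rewrite expr_div_n; have := exprn_gt0 k B0.
  clear G D0; clearbody E.
  move: (N%:R `^ (c - 1)) E ((N%:R `^ b) ^+ k) (X ^+ k) A0 E0 => A D B Z hA hD hB.
  by field; rewrite !gt_eqF.
apply: ler_wpM2l; first by rewrite invr_ge0 mulr_ge0// ltW.
apply: lerXn2r; rewrite ?nnegrE ?invr_ge0 ?divr_ge0 ?(ltW B0)//.
by rewrite ler_pdivrMr//; lra.
Qed.

End GeometricConvergence.

(** * Domination of coefficient terms by a single fractional integral *)

Section Restriction.
Context {R : realType}.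
Variables (T gam : R).
Hypotheses (T0 : 0 < T) (gam01 : 0 < gam < 1).
Implicit Types (f g v : R -> R) (t : R).
Let c := 1 - gam.
Let c0 : 0 < c. Proof. by rewrite subr_gt0; case/andP: gam01. Qed.

Lemma Cgamma_restrict f t : t <= T -> Cgamma T gam f -> Cgamma t gam f.
Proof.
move=> tT [h ch hE]; exists h.
  by apply: continuous_subspaceW ch; apply: subset_itvl; rewrite bnd_simp.
by move=> s /andP[s0 st]; apply: hE; rewrite s0 (le_trans st).
Qed.

Lemma Cgamma_Phi_bound f : Cgamma T gam f ->
  exists2 M, 0 <= M & forall t, 0 < t <= T -> `|f t| <= M * Phi c t.
Proof.
move=> /(CgammaP gam T0)[w [M [_ wM fE]]].
have G0 := Gamma_gt0 c c0.
have M0 : 0 <= M by apply: le_trans (wM 0); exact: normr_ge0.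
exists (M * Gamma c); first by rewrite mulr_ge0// ltW.
move=> t tT; have /andP[t0 _] := tT.
rewrite fE// -/c normrM ger0_norm ?pk_ge0// PhiE -pk_gt0E// mulrC.
by rewrite (_ : _ * _ * (_ / _) = M * pk c t) ?ler_wpM2r ?pk_ge0//; field; rewrite gt_eqF.
Qed.

(** A coefficient of size t^(-del) costs del orders of integration: I^rho is smaller than I^b by a
    factor t^(rho-b), and rho - b >= del. *)
Lemma term_le (e : R -> R) (del rho b E : R) : 0 < b -> 0 <= E -> b + del <= rho -> 0 <= del ->
  (forall t, 0 < t <= T -> `|e t| <= E * t `^ (- del)) ->
  exists C, forall v g t, Cgamma T gam v -> Cgamma T gam g -> 0 < t <= T ->
    (forall x, 0 < x <= T -> 0 <= g x) ->
    (forall x, 0 < x < t -> `|v x| <= g x) ->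
    `|e t * RLint rho v t| <= C * RLint b g t.
Proof.
move=> b0 E0 brho del0 eE; exists (E * (T `^ (rho - b - del) * Gamma b / Gamma rho)).
move=> v g t cv cg tT g0 vg; have /andP[t0 tT'] := tT.
have hr : 0 <= rho - b - del by lra.
have brho' : b <= rho by lra.
have rho0 : 0 < rho by exact: lt_le_trans brho'.
have h1 := RLint_norm_le T0 gam01 rho0 cv cg tT' vg.
have g0' x : 0 < x <= t -> 0 <= g x by move=> /andP[x0 xt]; apply: g0; rewrite x0 (le_trans xt).
(* The comparison of orders is used on [0,t], not on [0,T]: the factor t^(rho-b) is what absorbs
   t^(-del). *)
have h2 := RLint_order_le t0 gam01 b0 brho' (Cgamma_restrict tT' cg) (lexx t) g0'.
have I0 : 0 <= RLint b g t.
  have z0 : Cgamma T gam (fun=> 0) := @Cgamma0 R T gam.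
  have := RLint_norm_le T0 gam01 b0 z0 cg tT' _; rewrite (RLint0 t b0) normr0; apply.
  by move=> x /andP[x0 xt]; rewrite g0// x0 ltW// (lt_le_trans xt).
have G1 := Gamma_gt0 _ b0; have G2 := Gamma_gt0 _ rho0.
rewrite normrM.
apply: (@le_trans _ _ ((E * t `^ (- del)) * (t `^ (rho - b) * Gamma b / Gamma rho * RLint b g t))).
  by apply: ler_pM; [exact: normr_ge0|exact: normr_ge0|exact: eE|exact: le_trans h1 h2].
rewrite -!mulrA ler_wpM2l// !mulrA.
rewrite ler_wpM2r// ler_wpM2r ?invr_ge0 ?(ltW G2)// ler_wpM2r ?(ltW G1)//.
rewrite -powRD ?(gt_eqF t0) ?implybT// addrC.
apply: ge0_ler_powR; [exact: hr|rewrite nnegrE; exact: ltW|rewrite nnegrE; exact: ltW|exact: tT'].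
Qed.

Lemma sum_term_le (I : eqType) (r : seq I) (L : I -> (R -> R) -> R -> R) (b : R) :
  (forall i, i \in r -> exists C, forall v g t, Cgamma T gam v -> Cgamma T gam g -> 0 < t <= T ->
    (forall x, 0 < x <= T -> 0 <= g x) ->
    (forall x, 0 < x < t -> `|v x| <= g x) -> `|L i v t| <= C * RLint b g t) ->
  exists C, forall v g t, Cgamma T gam v -> Cgamma T gam g -> 0 < t <= T ->
    (forall x, 0 < x <= T -> 0 <= g x) ->
    (forall x, 0 < x < t -> `|v x| <= g x) -> `|\sum_(i <- r) L i v t| <= C * RLint b g t.
Proof.
elim: r => [|i r IHr] h.
  by exists 0 => v g t *; rewrite big_nil normr0 mul0r.
have [C1 h1] := h i (mem_head _ _).
have [C2 h2] : _ := IHr (fun j jr => h j (mem_behead (s := i :: r) jr)).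
exists (C1 + C2) => v g t cv cg tT g0 vg; rewrite big_cons mulrDl.
by apply: (le_trans (ler_normD _ _)); apply: lerD; [exact: h1|exact: h2].
Qed.

End Restriction.

(** * Volterra operators *)

Section Operator.
Context {R : realType}.
Variables (T gam b : R) (r : seq nat) (be : nat -> R) (a a' : nat -> R -> R).
Hypotheses (T0 : 0 < T) (gam01 : 0 < gam < 1) (b0 : 0 < b).
Hypothesis b_le : forall i, i \in r -> b <= be i.
Hypothesis ca : forall i, i \in r -> {within `[0, T], continuous (a i)}.
Hypothesis a0 : forall i, i \in r -> a i 0 = 0.
Hypothesis da : forall i t, i \in r -> 0 < t <= T -> is_der T (a i) t (a' i t).
Hypothesis ca' : forall i, i \in r -> Cgamma T gam (a' i).
Implicit Types (f g v : R -> R) (t : R) (i k : nat).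
Let c := 1 - gam.
Let c0 : 0 < c. Proof. by rewrite subr_gt0; case/andP: gam01. Qed.
Let gam0 : 0 < gam. Proof. by case/andP: gam01. Qed.
Let gam1 : gam < 1. Proof. by case/andP: gam01. Qed.

Let be0 i : i \in r -> 0 < be i. Proof. by move=> ir; exact: lt_le_trans (b_le ir). Qed.

Let be1 i : i \in r -> gam < 1 + be i.
Proof. by move=> /be0 h; have := gam1; move=> h1; lra. Qed.


Definition dop v t : R :=
  \sum_(i <- r) (a' i t * RLint (1 + be i) v t + a i t * RLint (be i) v t).

Lemma dop_Cgamma v : Cgamma T gam v -> Cgamma T gam (dop v).
Proof.
move=> cv; apply: Cgamma_sum => i ir; apply: CgammaD.
  apply: (@Cgamma_eq _ _ _ (fun t => RLint (1 + be i) v t * a' i t)).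
    by move=> t _; exact: mulrC.
  apply: Cgamma_mul; last exact: ca'.
  exact: (RLint_within T0 gam01 (be1 ir) cv).
by apply: Cgamma_mul; [exact: ca|exact: (RLint_Cgamma T0 gam01 (be0 ir) cv)].
Qed.

(* The product rule; a_i(0) = 0 removes the boundary term. *)
Lemma dop_RLint1 v t : Cgamma T gam v -> 0 <= t <= T ->
  \sum_(i <- r) a i t * RLint (be i) (RLint 1 v) t = RLint 1 (dop v) t.
Proof.
move=> cv tT.
pose F s := \sum_(i <- r) a i s * RLint (1 + be i) v s.
have FE s : 0 <= s <= T -> \sum_(i <- r) a i s * RLint (be i) (RLint 1 v) s = F s.
  move=> sT; apply: eq_big_seq => i ir.
  by rewrite (RLint_semigroup T0 gam01 (be0 ir) ltr01 cv sT) [be i + 1]addrC.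
rewrite (FE t tT).
have cF : {within `[0, T], continuous F}.
  have H (s : seq nat) : {subset s <= r} ->
      {within `[0, T], continuous (fun x => \sum_(i <- s) a i x * RLint (1 + be i) v x)}.
    elim: s => [_|i s IHs sr].
      rewrite (_ : (fun x => _) = cst 0); first by move=> x; exact: cvg_cst.
      by apply/funext => x; rewrite big_nil.
    rewrite (_ : (fun x => _) = fun x => a i x * RLint (1 + be i) v x +
      \sum_(i <- s) a i x * RLint (1 + be i) v x); last by apply/funext => x; rewrite big_cons.
    have ir : i \in r by apply: sr; rewrite mem_head.
    move=> x; apply: cvgD; last by apply: IHs => j js; apply: sr; rewrite in_cons js orbT.
    by apply: cvgM; [exact: ca|exact: (RLint_within T0 gam01 (be1 ir) cv)].
  by apply: H.
apply: (is_der_RLint1_unique T0 gam01 cF (dop_Cgamma cv) _ _ tT).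
- move=> s sT; apply: is_der_sum => i ir.
  by apply: is_derM; [exact: da|exact: (RLint_is_der T0 gam01 (be0 ir) cv sT)].
- by rewrite /F big1_seq// => i /andP[_ ir]; rewrite a0// mul0r.
Qed.

Let a_bound i : i \in r ->
  exists2 E : R, 0 <= E & forall t, 0 < t <= T -> `|a i t| <= E * t `^ (- 0).
Proof.
move=> ir; have [M hM] := within_continuous_bounded (ltW T0) (ca ir).
have M0 : 0 <= M by apply: le_trans (hM 0 _); [exact: normr_ge0|rewrite lexx ltW].
exists M => // t /andP[t0 tT].
by rewrite oppr0 powRr0 mulr1; apply: hM; rewrite ltW.
Qed.

Let a'_bound i : i \in r ->
  exists2 E : R, 0 <= E & forall t, 0 < t <= T -> `|a' i t| <= E * t `^ (- gam).
Proof.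
move=> ir; have /(CgammaP gam T0)[w [M [_ wM fE]]] := ca' ir.
have M0 : 0 <= M by apply: le_trans (wM 0); exact: normr_ge0.
exists M => // t tT; have /andP[t0 _] := tT.
rewrite fE// normrM ger0_norm ?pk_ge0// mulrC pk_gt0E//.
rewrite (_ : 1 - gam - 1 = - gam); last by ring.
by apply: ler_wpM2r; [exact: powR_ge0|exact: wM].
Qed.

Lemma vop_le : exists C, forall v g t, Cgamma T gam v -> Cgamma T gam g -> 0 < t <= T ->
  (forall x, 0 < x <= T -> 0 <= g x) -> (forall x, 0 < x < t -> `|v x| <= g x) ->
  `|\sum_(i <- r) a i t * RLint (be i) v t| <= C * RLint b g t.
Proof.
apply: (@sum_term_le R T gam nat r (fun i v t => a i t * RLint (be i) v t)) => i ir.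
have [E E0 hE] := a_bound ir.
by apply: (term_le T0 gam01 b0 E0 _ (lexx 0) hE); rewrite addr0; exact: b_le.
Qed.

(** [term_le] is applied with del = 0 to the bounded a_i and with del = gam to a_i'; the latter is
    affordable since b + gam <= 1 + be_i. *)
Lemma dop_le : exists C, forall v g t, Cgamma T gam v -> Cgamma T gam g -> 0 < t <= T ->
  (forall x, 0 < x <= T -> 0 <= g x) -> (forall x, 0 < x < t -> `|v x| <= g x) ->
  `|dop v t| <= C * RLint b g t.
Proof.
apply: (@sum_term_le R T gam nat r
  (fun i v t => a' i t * RLint (1 + be i) v t + a i t * RLint (be i) v t)) => i ir.
have [E1 E10 hE1] := a_bound ir; have [E2 E20 hE2] := a'_bound ir.
have hb1 : b + 0 <= be i by rewrite addr0; exact: b_le.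
have hb2 : b + gam <= 1 + be i by have := b_le ir; have := gam1; lra.
have [C1 h1] := term_le T0 gam01 b0 E10 hb1 (lexx 0) hE1.
have [C2 h2] := term_le T0 gam01 b0 E20 hb2 (ltW gam0) hE2.
exists (C2 + C1) => v g t cv cg tT g0 vg; rewrite mulrDl.
by apply: (le_trans (ler_normD _ _)); apply: lerD; [exact: h2|exact: h1].
Qed.

Section Iteration.
(* P is either dop, for the series, or the Volterra operator itself, for uniqueness. *)
Variables (P : (R -> R) -> R -> R) (C : R).
Hypothesis P_le : forall v g t, Cgamma T gam v -> Cgamma T gam g -> 0 < t <= T ->
  (forall x, 0 < x <= T -> 0 <= g x) -> (forall x, 0 < x < t -> `|v x| <= g x) ->
  `|P v t| <= C * RLint b g t.
Hypothesis P_Cgamma : forall v, Cgamma T gam v -> Cgamma T gam (P v).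

Let ck k : c <= c + k%:R * b. Proof. by rewrite lerDl mulr_ge0// ltW. Qed.
Let ck0 k : 0 < c + k%:R * b. Proof. exact: lt_le_trans (ck k). Qed.

Lemma Phi_ge0 (p x : R) : 0 < p -> 0 <= Phi p x.
Proof. by move=> p0; rewrite PhiE divr_ge0 ?powR_ge0// ltW// Gamma_gt0. Qed.

(** I^b maps Phi_(c+kb) to Phi_(c+(k+1)b), so each application of P raises the index by b. Only the
    values of v before t enter, which fits an equation holding on the open interval. *)
Lemma dominated_step v M k t : 0 <= M -> Cgamma T gam v -> 0 < t <= T ->
  (forall x, 0 < x < t -> `|v x| <= M * Phi (c + k%:R * b) x) ->
  `|P v t| <= (`|C| * M) * Phi (c + k.+1%:R * b) t.
Proof.
move=> M0 cv tT vM; have /andP[t0 tT'] := tT.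
have cP : Cgamma T gam (Phi (c + k%:R * b)) by exact: Phi_Cgamma.
have cg : Cgamma T gam (fun x => M * Phi (c + k%:R * b) x) by exact: CgammaZ.
have g0 x : 0 < x <= T -> 0 <= M * Phi (c + k%:R * b) x.
  by move=> _; rewrite mulr_ge0// Phi_ge0.
apply: (le_trans (P_le cv cg tT g0 vM)).
rewrite (RLintZ T0 gam01 _ b0 cP tT') (RLint_Phi b0 (ck0 k) t0).
have -> : b + (c + k%:R * b) = c + k.+1%:R * b by rewrite -[k.+1%:R]natr1; ring.
rewrite mulrA; apply: ler_wpM2r; first exact: Phi_ge0.
by apply: ler_wpM2r => //; exact: ler_norm.
Qed.

Lemma iter_Cgamma v k : Cgamma T gam v -> Cgamma T gam (iter k P v).
Proof. by move=> cv; elim: k => [//|k IHk]; rewrite iterS; exact: P_Cgamma. Qed.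

Lemma iter_le v M : 0 <= M -> Cgamma T gam v ->
  (forall x, 0 < x <= T -> `|v x| <= M * Phi c x) ->
  forall k t, 0 < t <= T -> `|iter k P v t| <= M * `|C| ^+ k * Phi (c + k%:R * b) t.
Proof.
move=> M0 cv vM; elim=> [|k IHk] t tT.
  by rewrite expr0 mulr1 mul0r addr0; exact: vM.
have M1 : 0 <= M * `|C| ^+ k by rewrite mulr_ge0// exprn_ge0.
have := dominated_step M1 (iter_Cgamma k cv) tT _.
rewrite iterS exprS mulrCA [`|C| * _]mulrC; apply => x /andP[x0 xt]; apply: IHk.
by rewrite x0 ltW// (lt_le_trans xt)//; case/andP: tT.
Qed.

Lemma Phi_geometric M : 0 <= M -> exists2 K, 0 <= K & forall k t, 0 < t <= T ->
  M * `|C| ^+ k * Phi (c + k%:R * b) t <= K * 2^-1 ^+ k * pk c t.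
Proof.
(* The ratio is |C| T^b, because t^(c+kb-1) = (t^b)^k t^(c-1) and t <= T; the factor t^(c-1) stays
   as the weight [pk c t]. *)
move=> M0; have X0 : 0 <= `|C| * T `^ b by rewrite mulr_ge0// powR_ge0.
have [K K0 hK] := Gamma_geometric X0 b0 c0.
exists (M * K); first by rewrite mulr_ge0.
move=> k t /andP[t0 tT].
have G := Gamma_gt0 _ (ck0 k).
apply: (@le_trans _ _ (M * ((`|C| * T `^ b) ^+ k / Gamma (c + k%:R * b)) * pk c t)); last first.
  by apply: ler_wpM2r; [exact: pk_ge0|rewrite -mulrA; apply: ler_wpM2l].
rewrite PhiE (_ : c + k%:R * b - 1 = b * k%:R + (c - 1)); last by ring.
rewrite powRD ?(gt_eqF t0) ?implybT// -pk_gt0E// powRrM powR_mulrn ?powR_ge0// exprMn.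
rewrite (_ : _ * _ * (_ / _) = M * (`|C| ^+ k * (t `^ b) ^+ k / Gamma (c + k%:R * b)) * pk c t); last first.
  by move: (Gamma _) (pk c t) (`|C| ^+ k) ((t `^ b) ^+ k) => A B D E; ring.
apply: ler_wpM2r; first exact: pk_ge0.
apply: ler_wpM2l => //; apply: ler_wpM2r; first by rewrite invr_ge0 ltW.
apply: ler_wpM2l; first by rewrite exprn_ge0.
apply: lerXn2r; rewrite ?nnegrE ?powR_ge0//.
by apply: ge0_ler_powR; rewrite ?nnegrE ?(ltW t0) ?(ltW T0) ?(ltW b0).
Qed.

(** The equation improves its own bound: by induction v is below M |C|^k Phi_(c+kb) for every k, and
    this tends to 0. Absolute values make the sign in x = - V x irrelevant. *)
Lemma fixed_point_zero v : Cgamma T gam v ->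
  (forall t, 0 < t < T -> `|v t| = `|P v t|) -> forall t, 0 < t < T -> v t = 0.
Proof.
move=> cv vP t tT; have [M M0 vM] := Cgamma_Phi_bound T0 gam01 cv.
have H k x : 0 < x < T -> `|v x| <= M * `|C| ^+ k * Phi (c + k%:R * b) x.
  elim: k x => [|k IHk] x xT; have /andP[x0 xT'] := xT.
    by rewrite expr0 mulr1 mul0r addr0; apply: vM; rewrite x0 ltW.
  have M1 : 0 <= M * `|C| ^+ k by rewrite mulr_ge0// exprn_ge0.
  have xTT : 0 < x <= T by rewrite x0 ltW.
  have := dominated_step M1 cv xTT _.
  rewrite -vP// exprS mulrCA [`|C| * _]mulrC; apply => y /andP[y0 yx]; apply: IHk.
  by rewrite y0 (lt_trans yx).
have [K K0 hK] := Phi_geometric M0; have /andP[t0 tT'] := tT.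
apply: (@eq0_geometric_le _ _ (K * pk c t)) => N.
have tTT : 0 < t <= T by rewrite t0 ltW.
by apply: (le_trans (H N t tT)); rewrite (mulrAC K); exact: hK.
Qed.

End Iteration.

End Operator.

(** * Neumann series *)

Lemma cvg_geometric (R : realType) (u : nat -> R) (l K : R) :
  (forall N, `|l - u N| <= K * 2^-1 ^+ N) -> u N @[N --> \oo] --> l.
Proof.
move=> h; have c0 := half_pow_cvg0 K.
apply/cvgrPdist_lt => e e0; move/cvgrPdist_lt : c0 => /(_ e e0).
apply: filterS => N; rewrite sub0r normrN => hN.
apply: le_lt_trans hN; apply: (le_trans (h N)); exact: ler_norm.
Qed.

(** Weighted estimates hold only for t > 0; continuity carries them to 0, the value taken by clamped
    functions on the negative axis. *)
Lemma continuous_at0_le (R : realType) (T B : R) (w : R -> R) : 0 < T -> continuous w ->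
  (forall t, 0 < t <= T -> `|w t| <= B) -> `|w 0| <= B.
Proof.
move=> T0 cw h; rewrite leNgt; apply/negP => Bw.
have e0 : 0 < `|w 0| - B by rewrite subr_gt0.
have /cvgrPdist_lt/(_ _ e0) := cw 0.
move=> /nbhs_ballP[d /= d0 hd].
pose s := Num.min (d / 2) T.
have s0 : 0 < s by rewrite lt_min T0 divr_gt0.
have sT : s <= T by rewrite ge_min lexx orbT.
have sd : s <= d / 2 by rewrite ge_min lexx.
have : `|w 0 - w s| < `|w 0| - B.
  by apply: hd; rewrite /ball/= sub0r normrN gtr0_norm//; lra.
have := h s; rewrite s0 sT => /(_ isT) h1 h2.
have h3 := lerB_dist (w 0) (w s); lra.
Qed.

Lemma within_eq_at0 (R : realType) (T : R) (f g : R -> R) : 0 < T ->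
  {within `[0, T], continuous f} -> {within `[0, T], continuous g} ->
  (forall t, 0 < t <= T -> f t = g t) -> f 0 = g 0.
Proof.
move=> T0 cf cg fg.
have cF := continuous_comp_clamp (ltW T0) cf; have cG := continuous_comp_clamp (ltW T0) cg.
have c00 : clamp T 0 = 0 by apply: clamp_id; rewrite lexx ltW.
have := @continuous_at0_le R T 0 (fun x => (f \o clamp T) x - (g \o clamp T) x) T0.
rewrite /= c00 => H; apply/eqP; rewrite -subr_eq0 -normr_le0; apply: H.
  by move=> x; apply: cvgB; [exact: cF|exact: cG].
move=> t tT; have /andP[t0 tT'] := tT.
by rewrite clamp_id ?tT' ?(ltW t0)// (fg t tT) subrr normr0.
Qed.

Section Neumann.
Context {R : realType}.
Variables (T gam b : R) (r : seq nat) (be : nat -> R) (a a' : nat -> R -> R).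
Hypotheses (T0 : 0 < T) (gam01 : 0 < gam < 1) (b0 : 0 < b).
Hypothesis b_le : forall i, i \in r -> b <= be i.
Hypothesis ca : forall i, i \in r -> {within `[0, T], continuous (a i)}.
Hypothesis ca' : forall i, i \in r -> Cgamma T gam (a' i).
Implicit Types (f g v : R -> R) (t : R) (i k : nat).
Let c := 1 - gam.
Let D := dop r be a a'.

Let be0 i : i \in r -> 0 < be i. Proof. by move=> ir; exact: lt_le_trans (b_le ir). Qed.
Let be10 i : i \in r -> 0 < 1 + be i. Proof. by move=> /be0 h; lra. Qed.

Lemma dop_lin l f g t : Cgamma T gam f -> Cgamma T gam g -> t <= T ->
  D (fun s => f s + l * g s) t = D f t + l * D g t.
Proof.
move=> cf cg tT; rewrite /D /dop big_distrr/= -big_split/=; apply: eq_big_seq => i ir.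
have clg := CgammaZ l cg.
rewrite (RLintD T0 gam01 (be0 ir) cf clg tT) (RLintD T0 gam01 (be10 ir) cf clg tT).
rewrite (RLintZ T0 gam01 _ (be0 ir) cg tT) (RLintZ T0 gam01 _ (be10 ir) cg tT).
move: (RLint _ f t) (RLint _ f t) (RLint _ g t) (RLint _ g t) => A B E F.
by ring.
Qed.

Lemma pk_Cgamma : Cgamma T gam (pk c).
Proof.
apply/(CgammaP gam T0); exists (fun=> 1), 1; split.
- by move=> x; exact: cvg_cst.
- by move=> x; rewrite normr1.
- by move=> t _; rewrite mulr1.
Qed.

Variables (phi : R -> R).
Hypothesis cphi : Cgamma T gam phi.

Let V k := iter k D phi.
Let cV k : Cgamma T gam (V k).
Proof. by apply: iter_Cgamma => // v; exact: (dop_Cgamma T0 gam01 b0 b_le ca ca'). Qed.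

Let S N t := \sum_(0 <= k < N) (-1) ^+ k * V k t.
Let cS N : Cgamma T gam (S N).
Proof. by apply: Cgamma_sum => k _; apply: CgammaZ; exact: cV. Qed.

Let S0 : S 0 = fun=> 0.
Proof. by apply/funext => t; rewrite /S big_nil. Qed.

Let SS N : S N.+1 = fun t => S N t + (-1) ^+ N * V N t.
Proof. by apply/funext => t; rewrite /S big_nat_recr. Qed.

(** Linearity shifts every term of the alternating sum by one; only the missing first term phi
    remains. *)
Let DS N t : 0 < t <= T -> D (S N) t = phi t - S N.+1 t.
Proof.
move=> /andP[t0 tT]; elim: N => [|N IHN].
  rewrite SS S0 expr0 mul1r add0r subrr /D /dop big1_seq// => i /andP[_ ir].
  by rewrite (RLint0 t (be0 ir)) (RLint0 t (be10 ir)) !mulr0 addr0.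
rewrite [in LHS]SS (dop_lin _ (cS N) (cV N) tT) IHN (SS N.+1) exprS.
have -> : V N.+1 t = D (V N) t by rewrite /V iterS.
by ring.
Qed.

Lemma neumann_series : exists v (K : R), [/\ Cgamma T gam v, 0 <= K,
  forall N t, 0 < t <= T ->
    `|v t - \sum_(0 <= k < N) (-1) ^+ k * iter k D phi t| <= K * 2^-1 ^+ N * pk c t
  & forall t, 0 < t <= T -> v t = phi t - D v t].
Proof.
have [C hC] := dop_le T0 gam01 b0 b_le ca ca'.
have [M M0 phiM] := Cgamma_Phi_bound T0 gam01 cphi.
have [K K0 hK] := Phi_geometric T0 gam01 b0 C M0.
have DC v : Cgamma T gam v -> Cgamma T gam (D v).
  exact: (dop_Cgamma T0 gam01 b0 b_le ca ca').
have VK k t : 0 < t <= T -> `|V k t| <= K * 2^-1 ^+ k * pk c t.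
  move=> tT; apply: le_trans (hK k t tT).
  exact: (iter_le T0 gam01 b0 hC DC M0 cphi phiM k tT).
have pkc0 t : 0 < t -> 0 < pk c t by move=> t0; rewrite pk_gt0E// powR_gt0.
have /choice[w hw] : forall k, exists w : R -> R, continuous w /\
    forall t, 0 < t <= T -> V k t = pk c t * w t.
  by move=> k; have /(CgammaP gam T0)[w [M' [cw _ wE]]] := cV k; exists w.
(* The factor [w k] is controlled only on [0,T]; clamping its argument makes the geometric bound
   global. *)
pose w_ k x := (-1) ^+ k * (w k \o clamp T) x.
have cw k : continuous (w_ k).
  move=> x; apply: cvgMr; apply: continuous_comp; first exact: continuous_clamp.
  by have [cwk _] := hw k; exact: cwk.
have wpos k t : 0 < t <= T -> `|w k t| <= K * 2^-1 ^+ k.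
  move=> tT; have /andP[t0 _] := tT; have [_ wE] := hw k.
  have := VK k t tT; rewrite wE// normrM (gtr0_norm (pkc0 _ t0)) mulrC.
  by rewrite ler_pM2r// pkc0.
have wK k x : `|w_ k x| <= K * 2^-1 ^+ k.
  rewrite /w_ normrM normrX normrN1 expr1n mul1r /=.
  have /andP[x0 xT] := clamp_itv x (ltW T0).
  move: x0; rewrite le_eqVlt => /predU1P[<-|x0]; last by apply: wpos; rewrite x0.
  by apply: (continuous_at0_le T0); [have [] := hw k|exact: wpos].
have [W cW hW] := geometric_uniform_continuous K0 cw wK.
pose v t := pk c t * W t.
have cv : Cgamma T gam v.
  exists W; first exact: continuous_subspaceT.
  by move=> t /andP[t0 _]; rewrite /v mulrA gam_pkc// mul1r.
have vS N t : 0 < t <= T -> `|v t - S N t| <= 2 * K * 2^-1 ^+ N * pk c t.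
  move=> tT; have /andP[t0 tT'] := tT.
  rewrite (_ : S N t = pk c t * \sum_(0 <= k < N) w_ k t).
    rewrite /v -mulrBr normrM (gtr0_norm (pkc0 _ t0)) mulrC.
    by apply: ler_wpM2r; [exact: pk_ge0|exact: hW].
  rewrite /S big_distrr/=; apply: eq_bigr => k _.
  by have [_ ->//] := hw k; rewrite /w_/= clamp_id ?tT' ?(ltW t0)// mulrCA.
have K20 : 0 <= 2 * K by rewrite mulr_ge0.
exists v, (2 * K); split => //.
move=> t tT; have /andP[t0 tT'] := tT.
apply/eqP; rewrite -subr_eq0; apply/eqP.
(* The residual is independent of N. By [DS] it equals (v - S_(N+1)) + D (v - S_N), and both
   summands are bounded by constants times 2^(-N) at the given t. *)
apply: (@eq0_geometric_le _ _ (2 * K * pk c t + C * (2 * K * RLint b (pk c) t))) => N.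
have E : v t - (phi t - D v t) = (v t - S N.+1 t) + D (fun s => v s + -1 * S N s) t.
  by rewrite (dop_lin _ cv (cS N) tT') (DS N tT); ring.
have F : `|D (fun s => v s + -1 * S N s) t| <= C * (2 * K * 2^-1 ^+ N * RLint b (pk c) t).
  have cg : Cgamma T gam (fun x => 2 * K * 2^-1 ^+ N * pk c x) by apply: CgammaZ; exact: pk_Cgamma.
  rewrite -(RLintZ T0 gam01 _ b0 pk_Cgamma tT').
  apply: hC => //; first by apply: CgammaD => //; exact: CgammaZ.
    move=> x _; apply: mulr_ge0; last exact: pk_ge0.
    by apply: mulr_ge0 => //; rewrite exprn_ge0.
  move=> x /andP[x0 xt]; rewrite mulN1r; apply: vS.
  by rewrite x0 (le_trans (ltW xt)).
rewrite E; apply: (le_trans (ler_normD _ _)); apply: (le_trans (lerD (vS _ _ tT) F)).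
rewrite [leRHS]mulrDl; apply: lerD; last first.
  by move: (RLint _ _ _) => A; rewrite le_eqVlt; apply/orP; left; apply/eqP; ring.
rewrite mulrAC; apply: ler_wpM2l; first by rewrite mulr_ge0// pk_ge0.
by rewrite [leRHS]half_powS lerDl exprn_ge0.
Qed.

(** The weighted error bound is integrated against the positive kernel, so the error of the
    integrated partial sums is at most 2^(-N) K I^p (pk c). *)
Lemma RLint_series p v (K t : R) : 0 < p -> Cgamma T gam v -> 0 <= K -> 0 <= t <= T ->
  (forall N t, 0 < t <= T ->
    `|v t - \sum_(0 <= k < N) (-1) ^+ k * iter k D phi t| <= K * 2^-1 ^+ N * pk c t) ->
  \sum_(0 <= k < N) (-1) ^+ k * RLint p (iter k D phi) t @[N --> \oo] --> RLint p v t.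
Proof.
move=> p0 cv K0 /andP[t0 tT] vS.
apply: (@cvg_geometric _ _ _ (K * RLint p (pk c) t)) => N.
have -> : \sum_(0 <= k < N) (-1) ^+ k * RLint p (iter k D phi) t = RLint p (S N) t.
  rewrite (RLint_sum T0 gam01 p0 _ tT); last by move=> k _; apply: CgammaZ; exact: cV.
  by apply: eq_bigr => k _; rewrite (RLintZ T0 gam01 _ p0 (cV k) tT).
rewrite -(RLintB T0 gam01 p0 cv (cS N) tT) [leRHS]mulrAC -(RLintZ T0 gam01 _ p0 pk_Cgamma tT).
apply: (RLint_norm_le T0 gam01 p0 _ _ tT).
- by apply: CgammaB.
- by apply: CgammaZ; exact: pk_Cgamma.
- by move=> x /andP[x0 xt]; apply: vS; rewrite x0 (le_trans (ltW xt)).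
Qed.

End Neumann.

Lemma nceil_eq (R : realType) (al : R) (N : nat) : N%:R - 1 < al <= N%:R -> nceil al = N.
Proof.
move=> h; rewrite /nceil (_ : Num.ceil al = N%:Z)//.
by apply: ceil_def; rewrite rmorphB/= -pmulrn.
Qed.

(** * Consequences of the hypotheses on one coefficient *)

Section Coefficient.
Context {R : realType}.
Variables (T gam : R) (a : R -> R).
Hypotheses (T0 : 0 < T) (gam01 : 0 < gam < 1) (ca : Cngamma T 1 gam a).
Let gam0 : 0 < gam. Proof. by case/andP: gam01. Qed.
Let gam1 : gam < 1. Proof. by case/andP: gam01. Qed.
Let a' := derive_on T a.

Lemma Cngamma1_within : {within `[0, T], continuous a}.
Proof. by case: ca => _ h _ _; exact: (h 0%N isT). Qed.

Lemma Cngamma1_is_der t : 0 < t <= T -> is_der T a t (a' t).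
Proof.
by case: ca => _ _ h _ tT; apply: derivable_is_der; exact: (h t tT 0%N isT).
Qed.

Lemma Cngamma1_Cgamma : Cgamma T gam a'.
Proof. by case: ca. Qed.

(* I^(1-gam) a = I^1 g with g continuous, hence I^1 a = I^(1+gam) g and a = I^gam g. *)
Lemma RLderivable_at0 : (forall t, 0 < t <= T -> RLderivable T gam a t) ->
  Cgamma T 0 (RLderive T gam a) -> a 0 = 0.
Proof.
have gam1' := gam1; have gam0' := gam0.
have -> : RLderive T gam a = deriven_on T 1 (RLint (1 - gam) a).
  by rewrite /RLderive (@nceil_eq _ _ 1)//; apply/andP; split; lra.
have RD t : RLderivable T gam a t = derivablen_on T 1 (RLint (1 - gam) a) t.
  by rewrite /RLderivable (@nceil_eq _ _ 1)//; apply/andP; split; lra.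
move=> dF [g cg gE].
pose F := RLint (1 - gam) a.
have q0 : 0 < 1 - gam by lra.
(* Here a and g are continuous, hence in C_e for any e in (0,1). Taking e below both gam and 1 - gam
   makes I^(1-gam) a and I^gam g continuous up to 0, which the weight gam itself would not
   guarantee. *)
pose e := Num.min gam (1 - gam) / 2.
have m0 : 0 < Num.min gam (1 - gam) by rewrite lt_min gam0.
have m1 : Num.min gam (1 - gam) <= gam by rewrite ge_min lexx.
have m2 : Num.min gam (1 - gam) <= 1 - gam by rewrite ge_min lexx orbT.
have e01 : 0 < e < 1 by rewrite /e; apply/andP; split; lra.
have e1 : e < 1 - gam by rewrite /e; lra.
have e2 : e < gam by rewrite /e; lra.
have cae : Cgamma T e a := within_Cgamma e01 Cngamma1_within.
have cge : Cgamma T e g := within_Cgamma e01 cg.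
have FE t : 0 <= t <= T -> F t = RLint 1 g t.
  move=> tT; apply: (is_der_RLint1_unique T0 e01 _ cge _ _ tT).
  - exact: (RLint_within T0 e01 e1 cae).
  - move=> s sT; rewrite gE// powRr0 mul1r.
    apply: derivable_is_der; have := dF s sT; rewrite RD => h; exact: (h 0%N isT).
  - exact: (RLint_t0 a q0).
have IE t : 0 <= t <= T -> RLint 1 a t = RLint (1 + gam) g t.
  move=> tT; have /andP[t0 tT'] := tT.
  have := RLint_semigroup T0 e01 gam0 q0 cae tT.
  have -> : gam + (1 - gam) = 1 by ring.
  move=> <-; rewrite [1 + gam]addrC -(RLint_semigroup T0 e01 gam0 ltr01 cge tT).
  apply: (RLint_eq T0 gam0 tT' (RLint_Cgamma T0 e01 q0 cae)) => x /andP[x0 xt].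
  by apply: FE; rewrite (ltW x0) (le_trans (ltW xt)).
have aE t : 0 < t <= T -> a t = RLint gam g t.
  move=> tT; have /andP[t0 tT'] := tT.
  have tT0 : 0 <= t <= T by rewrite ltW.
  have d1 := RLint1_is_der T0 e01 cae tT.
  have d2 := RLint_is_der T0 e01 gam0 cge tT.
  rewrite -(is_der_derive_on T0 tT0 d2); symmetry.
  apply: (is_der_derive_on T0 tT0).
  apply: (is_der_eq (@rel_open_lopen_itv _ T) _ tT d1) => s /andP[s0 sT].
  by apply: IE; rewrite ltW.
have cI : {within `[0, T], continuous (RLint gam g)} := RLint_within T0 e01 e2 cge.
by rewrite (within_eq_at0 T0 Cngamma1_within cI aE) (RLint_t0 g gam0).
Qed.

Hypothesis a0 : a 0 = 0.

Let aE t : 0 <= t <= T -> a t = RLint 1 a' t.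
Proof.
apply: (is_der_RLint1_unique T0 gam01 Cngamma1_within Cngamma1_Cgamma _ a0).
exact: Cngamma1_is_der.
Qed.

(** Since a = I^1 a' has the form t^(1-gam) u(t), the product weighted by t^gam is a multiple of
    t^del u(t), continuous at 0 however small del is. *)
Let aPhi_Cgamma del : 0 < del -> Cgamma T gam (fun t => a t * Phi del t).
Proof.
move=> del0; have [u cu uE] := RLint_rep T0 gam01 ltr01 Cngamma1_Cgamma.
have G0 := lt0r_neq0 (Gamma_gt0 _ del0).
exists (fun t => (Gamma del)^-1 * (pk (del + 1) t * u t)).
  apply: continuous_subspaceT => x; apply: cvgMr; apply: cvgM; last exact: cu.
  by apply: continuous_pk; rewrite ltrDr.
move=> t /andP[t0 tT]; rewrite aE ?(ltW t0)// uE ?(ltW t0)//.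
rewrite !pk_gt0E// PhiE.
have -> : del + 1 - 1 = gam + (1 + (1 - gam) - 1) + (del - 1) by ring.
rewrite !powRD ?(gt_eqF t0) ?implybT//.
by move: (t `^ _) (t `^ _) (t `^ _) (u t) (Gamma _)^-1 => A B E F G; ring.
Qed.

(** phi is the product-rule derivative a' Phi_(1+del) + a Phi_del, and a(0) = 0 removes the boundary
    value. For del = 0 the factor Phi_1 is 1 and phi is a' alone. It is used with del = j -
    alpha_i. *)
Lemma coef_Phi_RLint1 del : 0 <= del -> exists2 phi, Cgamma T gam phi &
  forall t, 0 < t <= T -> a t * Phi (1 + del) t = RLint 1 phi t.
Proof.
rewrite le_eqVlt => /predU1P[<-|del0].
  exists a' => [|t /andP[t0 tT]]; first exact: Cngamma1_Cgamma.
  rewrite PhiE addr0 subrr powRr0 Gamma1 divr1 mulr1.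
  by apply: aE; rewrite ltW.
have G0 := lt0r_neq0 (Gamma_gt0 _ del0).
pose phi t := a' t * Phi (1 + del) t + a t * Phi del t.
have del1 : 1 < 1 + del by rewrite ltrDl.
have del10 : 1 + del != 0 by rewrite gt_eqF// addr_gt0.
have PE t : 0 <= t -> Phi (1 + del) t = pk (1 + del) t / Gamma (1 + del).
  rewrite PhiE le_eqVlt => /predU1P[<-|t0]; last by rewrite pk_gt0E.
  rewrite pk_le0// powR0; first by [].
  by rewrite [1 + del]addrC addrK gt_eqF.
have cP : {within `[0, T], continuous (Phi (1 + del))}.
  apply: (@subspace_eq_continuous _ _ _ (fun t => pk (1 + del) t / Gamma (1 + del))).
    by move=> x; rewrite inE/= in_itv/= => /andP[x0 _]; exact/esym/PE.
  apply: continuous_subspaceT => x; apply: cvgMl; exact: continuous_pk.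
have cphi : Cgamma T gam phi.
  apply: CgammaD; last exact: aPhi_Cgamma.
  apply: (@Cgamma_eq _ _ _ (fun t => Phi (1 + del) t * a' t)).
    by move=> t _; exact: mulrC.
  exact: Cgamma_mul cP Cngamma1_Cgamma.
exists phi => // t /andP[t0 tT]; have tT0 : 0 <= t <= T by rewrite ltW.
pose F t := a t * Phi (1 + del) t.
apply: (is_der_RLint1_unique T0 gam01 (F := F) _ cphi _ _ tT0).
- by move=> x; apply: cvgM; [exact: Cngamma1_within|exact: cP].
- move=> s sT; have /andP[s0 _] := sT.
  apply: is_derM; first exact: Cngamma1_is_der.
  have := is_derZ (Gamma (1 + del))^-1 (is_derive_is_der T (is_derive1_powR del s0)).
  rewrite (_ : _ * (_ * _) = Phi del s); last first.
    rewrite PhiE [1 + del]addrC GammaS//.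
    move: (s `^ _) => A; have del0' := lt0r_neq0 del0; by field; rewrite G0 del0'.
  apply: (is_der_eq (@rel_open_closed_itv _ T)); last by rewrite ltW//; case/andP: sT.
  move=> x _; rewrite PhiE [1 + del]addrC addrK; exact: mulrC.
- by rewrite /F a0 mul0r.
Qed.

End Coefficient.

(** * The fractional equation *)

Section FractionalEquation.
Context {R : realType}.
Variables (T gam : R) (m : nat) (alpha : nat -> R) (n : nat -> nat) (a : nat -> R -> R).
Hypotheses (T0 : 0 < T) (gam01 : 0 < gam < 1).
Hypothesis alpha_le : forall i k, (i <= k <= m)%N -> alpha k <= alpha i.
Hypothesis alpha10 : alpha 1%N < alpha 0%N.
Hypothesis alpha1_ge0 : 0 <= alpha 1%N.
Hypothesis hn : forall i, (i <= m)%N -> (n i)%:R - 1 < alpha i <= (n i)%:R.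
Hypothesis gamE : gam = (n 0%N)%:R - alpha 0%N.
Hypothesis ca : forall i, (1 <= i <= m)%N -> Cngamma T 1 gam (a i).
Hypothesis a0 : forall i, (1 <= i <= m)%N -> a i 0 = 0.
Implicit Types (i j k N : nat) (t x : R) (z om v phi : R -> R).
Let r := index_iota 1 m.+1.
Let be i := alpha 0%N - alpha i.
Let b := be 1%N.
Let a' i := derive_on T (a i).
Let n0 := n 0%N.
Let D := dop r be a a'.
Let theta j i : R := (n i <= j)%N%:R.

Let gam0 : 0 < gam. Proof. by case/andP: gam01. Qed.
Let gam1 : gam < 1. Proof. by case/andP: gam01. Qed.
Let q0 : 0 < 1 - gam. Proof. by rewrite subr_gt0. Qed.

Let rP i : i \in r = (1 <= i <= m)%N.
Proof. by rewrite mem_index_iota ltnS. Qed.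

Let alpha_lt i : i \in r -> alpha i < alpha 0%N.
Proof.
by rewrite rP => /andP[i1 im]; apply: le_lt_trans alpha10; apply: alpha_le; rewrite i1.
Qed.

Let alpha0_lt : alpha 0%N < n0%:R.
Proof. by have := gam0; rewrite gamE subr_gt0. Qed.

Let alpha0_gt0 : 0 < alpha 0%N.
Proof. exact: le_lt_trans alpha10. Qed.

Let b0 : 0 < b. Proof. by rewrite /b /be subr_gt0. Qed.

Let b_le i : i \in r -> b <= be i.
Proof. by rewrite rP => /andP[i1 im]; rewrite /b /be lerD2l lerN2 alpha_le// i1. Qed.

Let be0 i : i \in r -> 0 < be i.
Proof. by move=> ir; exact: lt_le_trans (b_le ir). Qed.

Let wa i : i \in r -> {within `[0, T], continuous (a i)}.
Proof. by rewrite rP => /ca h; exact: Cngamma1_within h. Qed.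

Let a0r i : i \in r -> a i 0 = 0. Proof. by rewrite rP; exact: a0. Qed.

Let da i t : i \in r -> 0 < t <= T -> is_der T (a i) t (a' i t).
Proof. by rewrite rP => /ca h; exact: Cngamma1_is_der h _. Qed.

Let ca' i : i \in r -> Cgamma T gam (a' i).
Proof. by rewrite rP => /ca h; exact: Cngamma1_Cgamma h. Qed.

Let n_le i : i \in r -> (n i <= n0)%N.
Proof.
move=> ir; have h := alpha_lt ir; have := ir; rewrite rP => /andP[_ im].
have /andP[h1 _] := hn im; rewrite -ltnS -(ltr_nat R) -natr1.
have := alpha0_lt; lra.
Qed.

Lemma n_le_alpha i j : (i <= m)%N -> (n i <= j)%N = (alpha i <= j%:R).
Proof.
move=> im; have /andP[h1 h2] := hn im; apply/idP/idP => [nj|aj].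
  by apply: (le_trans h2); rewrite ler_nat.
by rewrite -ltnS -(ltr_nat R) -natr1; lra.
Qed.

Section TaylorSolution.
Variables (j : nat) (z om : R -> R).
Hypotheses (jn : (j < n0)%N) (com : Cgamma T gam om).
Hypothesis zE : forall t, 0 <= t <= T -> z t = mono j 0 t + RLint n0%:R om t.

Let cap i t : (i <= m)%N -> 0 < t <= T -> caputo_derivable T (alpha i) z t /\
  caputo T (alpha i) z t = theta j i * Phi (j.+1%:R - alpha i) t + RLint (n0%:R - alpha i) om t.
Proof.
move=> im tT; have nc := nceil_eq (hn im).
have [nl al] : (n i <= n0)%N /\ alpha i < n0%:R.
  case: i im nc => [|i] im nc; first by split; [exact: leqnn|exact: alpha0_lt].
  have ir : i.+1 \in r by rewrite rP.
  by split; [exact: n_le|exact: lt_trans (alpha_lt ir) alpha0_lt].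
split; first exact: (taylor_caputo_derivable T0 gam01 jn com zE nc (hn im) nl al tT).
exact: (taylor_caputo T0 gam01 jn com zE nc (hn im) nl al tT).
Qed.

Lemma solution_taylor : solution T m alpha a z <-> forall t, 0 < t < T ->
  RLint gam om t =
  - \sum_(i <- r) a i t * (theta j i * Phi (j.+1%:R - alpha i) t + RLint (n0%:R - alpha i) om t).
Proof.
have E t : 0 < t < T -> caputo T (alpha 0%N) z t = RLint gam om t /\
    \sum_(1 <= i < m.+1) a i t * caputo T (alpha i) z t =
    \sum_(i <- r) a i t * (theta j i * Phi (j.+1%:R - alpha i) t + RLint (n0%:R - alpha i) om t).
  move=> /andP[t0 tT]; have tT' : 0 < t <= T by rewrite t0 ltW.
  have [_ ->] := cap (leq0n m) tT'.
  (* At index 0 the Taylor polynomial has order n_0 > j, so the monomial is removed and only I^gam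
     om is left. *)
  rewrite -gamE {1}/theta leqNgt jn mul0r add0r; split => //.
  by apply: eq_big_seq => i; rewrite rP => /andP[_ im]; have [_ ->] := cap im tT'.
split=> h t tT; have [E1 E2] := E t tT.
  by have [_] := h t tT; rewrite E1 E2.
split; last by rewrite E1 E2; exact: h.
move=> i im; have /andP[t0 tT'] := tT.
by have [] := cap im (_ : 0 < t <= T); first by rewrite t0 ltW.
Qed.

End TaylorSolution.

Lemma source_RLint1 j : exists2 phi, Cgamma T gam phi & forall t, 0 < t <= T ->
  \sum_(i <- r) a i t * (theta j i * Phi (j.+1%:R - alpha i) t) = RLint 1 phi t.
Proof.
have /choice[phi hphi] : forall i, exists phi, i \in r -> Cgamma T gam phi /\
    forall t, 0 < t <= T -> a i t * (theta j i * Phi (j.+1%:R - alpha i) t) = RLint 1 phi t.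
  move=> i; have [ir|ir] := boolP (i \in r); last by exists (fun=> 0).
  have := ir; rewrite rP => im; rewrite /theta.
  have [nj|nj] := leqP (n i) j; last first.
    exists (fun=> 0) => _; split; first exact: Cgamma0.
    by move=> t _; rewrite mul0r mulr0 RLint0.
  have del0 : 0 <= j%:R - alpha i.
    by rewrite subr_ge0 -n_le_alpha//; case/andP: im.
  have [phi cphi hphi] := coef_Phi_RLint1 T0 gam01 (ca im) (a0 im) del0.
  exists phi => _; split => // t tT; rewrite mul1r -(hphi t tT).
  by rewrite addrA -[1 + j%:R]addrC natr1.
exists (fun t => \sum_(i <- r) phi i t).
  by apply: Cgamma_sum => i ir; have [] := hphi i ir.
move=> t tT; have /andP[_ tT'] := tT.
rewrite (RLint_sum T0 gam01 ltr01 _ tT'); last by move=> i ir; have [] := hphi i ir.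
by apply: eq_big_seq => i ir; have [_ ->] := hphi i ir.
Qed.

(** I^1 intertwines the two operators, [Bop] after I^1 being I^1 after [D] by [dop_RLint1]; this
    passes to the iterates. *)
Lemma iter_Bop_RLint1 f phi k : Cgamma T gam phi ->
  (forall t, 0 < t <= T -> f t = RLint 1 phi t) ->
  forall t, 0 < t <= T -> iter k (Bop m alpha a) f t = RLint 1 (iter k D phi) t.
Proof.
move=> cphi fE; have cD v : Cgamma T gam v -> Cgamma T gam (D v).
  exact: (dop_Cgamma T0 gam01 b0 b_le wa ca').
elim: k => [//|k IHk] t tT; have /andP[t0 tT'] := tT.
have cV : Cgamma T gam (iter k D phi) := iter_Cgamma cD k cphi.
have c1 := RLint_Cgamma T0 gam01 ltr01 cV.
rewrite !iterS -(dop_RLint1 T0 gam01 b0 b_le wa a0r da ca' cV); last by rewrite (ltW t0).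
apply: eq_big_seq => i ir.
rewrite -(RLint_eq T0 (be0 ir) tT' c1 (g := iter k (Bop m alpha a) f)) //.
by move=> x /andP[x0 xt]; rewrite IHk// x0 (le_trans (ltW xt)).
Qed.

Lemma solution_exists j : exists om, [/\ Cgamma T gam om,
  forall t, 0 < t < T -> RLint gam om t =
  - \sum_(i <- r) a i t * (theta j i * Phi (j.+1%:R - alpha i) t + RLint (n0%:R - alpha i) om t)
  & forall h t, 0 <= t <= T -> (forall i, i \in r -> (h <= i)%N = (n i <= j)%N) -> (1 <= h)%N ->
    \sum_(0 <= k < N) series_term m alpha a h j k t @[N --> \oo] --> RLint n0%:R om t].
Proof.
have [phi cphi fE] := source_RLint1 j.
have [v [K [cv K0 vS vE]]] := neumann_series T0 gam01 b0 b_le wa ca' cphi.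
have cq : Cgamma T gam (RLint (1 - gam) v) := RLint_Cgamma T0 gam01 q0 cv.
have cDv : Cgamma T gam (D v) := dop_Cgamma T0 gam01 b0 b_le wa ca' cv.
have ag : 0 < alpha 0%N + 1 by rewrite addr_gt0.
(* This om makes I^gam om = - I^1 v, and I^(n_0-alpha_i) om = - I^(be_i) (I^1 v), so the equation
   becomes I^1 applied to v = phi - D v. *)
exists (fun t => - RLint (1 - gam) v t); split; first exact: CgammaN.
- move=> t /andP[t0 tT]; have tT' := ltW tT.
  have tT1 : 0 <= t <= T by rewrite !ltW.
  have tT2 : 0 < t <= T by rewrite t0 ltW.
  rewrite (RLintN T0 gam01 gam0 cq tT') (RLint_semigroup T0 gam01 gam0 q0 cv tT1).
  have -> : gam + (1 - gam) = 1 by ring.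
  have E i : i \in r -> a i t * (theta j i * Phi (j.+1%:R - alpha i) t +
      RLint (n0%:R - alpha i) (fun x => - RLint (1 - gam) v x) t) =
      a i t * (theta j i * Phi (j.+1%:R - alpha i) t) - a i t * RLint (be i) (RLint 1 v) t.
    move=> ir; have p0 : 0 < n0%:R - alpha i.
      by rewrite subr_gt0; apply: lt_trans (alpha_lt ir) alpha0_lt.
    rewrite (RLintN T0 gam01 p0 cq tT') (RLint_semigroup T0 gam01 p0 q0 cv tT1).
    rewrite (RLint_semigroup T0 gam01 (be0 ir) ltr01 cv tT1).
    have -> : n0%:R - alpha i + (1 - gam) = be i + 1 by rewrite /be gamE /n0; ring.
    by rewrite mulrDr mulrN.
  rewrite (eq_big_seq _ E) sumrB fE//.
  rewrite (dop_RLint1 T0 gam01 b0 b_le wa a0r da ca' cv tT1).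
  rewrite -(RLintB T0 gam01 ltr01 cphi cDv tT'); congr (- _).
  by apply: (RLint_eq T0 ltr01 tT' cv) => x /andP[x0 xt]; rewrite vE// x0 (le_trans (ltW xt))// ltW.
- move=> h t tT hE h1; have /andP[t0 tT'] := tT.
  have np : 0 < n0%:R :> R by exact: lt_trans alpha0_gt0 alpha0_lt.
  rewrite (RLintN T0 gam01 np cq tT') (RLint_semigroup T0 gam01 np q0 cv tT).
  have -> : n0%:R + (1 - gam) = alpha 0%N + 1 by rewrite gamE /n0; ring.
  pose f s := \sum_(h <= i < m.+1) a i s * Phi (j.+1%:R - alpha i) s.
  have ff s : 0 < s <= T -> f s = RLint 1 phi s.
    move=> sT; rewrite -fE// /f.
    (* By [hE], starting the sum at h is the same as inserting the indicator theta into the full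
       sum. *)
    rewrite (big_nat_widenl _ 1)//= big_mkcond/=; apply: eq_big_seq => i ir.
    by rewrite /theta -(hE i ir); case: (h <= i)%N; rewrite ?mul1r// mul0r mulr0.
  (* The minus sign in om accounts for the exponent k + 1 of -1 in the series. *)
  rewrite (_ : (fun N => _) = (fun N =>
    - \sum_(0 <= k < N) (-1) ^+ k * RLint (alpha 0%N + 1) (iter k D phi) t)).
    apply: cvgN; exact: (RLint_series T0 gam01 b0 b_le wa ca' cphi ag cv K0 tT vS).
  apply/funext => N; rewrite -sumrN; apply: eq_bigr => k _.
  rewrite /series_term exprS mulN1r mulNr; congr (- (_ * _)).
  have cV : Cgamma T gam (iter k D phi).
    by apply: iter_Cgamma => // u; exact: (dop_Cgamma T0 gam01 b0 b_le wa ca').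
  rewrite -(RLint_semigroup T0 gam01 alpha0_gt0 ltr01 cV tT); symmetry.
  apply: (RLint_eq T0 alpha0_gt0 tT' (RLint_Cgamma T0 gam01 ltr01 cV)) => x /andP[x0 xt].
  by rewrite (iter_Bop_RLint1 k cphi ff)// x0 (le_trans (ltW xt)).
Qed.

(** For om = om1 - om2 the sources cancel, and x = I^gam om satisfies the homogeneous Volterra
    equation, hence vanishes. Then I^(n_0) om = I^(alpha_0) x = 0. *)
Lemma solution_unique j om1 om2 t : 0 <= t <= T ->
  Cgamma T gam om1 -> Cgamma T gam om2 ->
  (forall s, 0 < s < T -> RLint gam om1 s =
  - \sum_(i <- r) a i s * (theta j i * Phi (j.+1%:R - alpha i) s + RLint (n0%:R - alpha i) om1 s)) ->
  (forall s, 0 < s < T -> RLint gam om2 s =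
  - \sum_(i <- r) a i s * (theta j i * Phi (j.+1%:R - alpha i) s + RLint (n0%:R - alpha i) om2 s)) ->
  RLint n0%:R om1 t = RLint n0%:R om2 t.
Proof.
move=> tT c1 c2 e1 e2; have /andP[t0 tT'] := tT.
pose om s := om1 s - om2 s; have com : Cgamma T gam om by exact: CgammaB.
pose x := RLint gam om; have cx : Cgamma T gam x := RLint_Cgamma T0 gam01 gam0 com.
have [C hC] := vop_le T0 gam01 b0 b_le wa.
have np : 0 < n0%:R :> R by exact: lt_trans alpha0_gt0 alpha0_lt.
have x0 s : 0 < s < T -> x s = 0.
  apply: (fixed_point_zero T0 gam01 b0 hC cx) => {}s sT; have /andP[s0 sT'] := sT.
  have sT1 : 0 <= s <= T by rewrite !ltW.
  rewrite -[RHS]normrN; congr (`|_|).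
  rewrite {1}/x /om (RLintB T0 gam01 gam0 c1 c2 (ltW sT')) (e1 s sT) (e2 s sT).
  rewrite -opprD -sumrB; congr (- _); apply: eq_big_seq => i ir.
  have p0 : 0 < n0%:R - alpha i.
    by rewrite subr_gt0; apply: lt_trans (alpha_lt ir) alpha0_lt.
  rewrite /x (RLint_semigroup T0 gam01 (be0 ir) gam0 com sT1).
  have -> : be i + gam = n0%:R - alpha i by rewrite /be gamE /n0; ring.
  rewrite /om (RLintB T0 gam01 p0 c1 c2 (ltW sT')).
  by move: (RLint _ _ _) (RLint _ _ _) (_ * Phi _ _) => A B E; ring.
apply/eqP; rewrite -subr_eq0 -(RLintB T0 gam01 np c1 c2 tT'); apply/eqP.
have E : n0%:R = alpha 0%N + gam by rewrite gamE /n0; ring.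
rewrite E -(RLint_semigroup T0 gam01 alpha0_gt0 gam0 com tT) -(RLint0 t alpha0_gt0).
apply: (RLint_eq T0 alpha0_gt0 tT' cx) => s /andP[s0 st].
by apply: x0; rewrite s0 (lt_le_trans st).
Qed.

End FractionalEquation.

Theorem theorem3 (R : realType) (T : R) (m : nat) (alpha : nat -> R)
    (n : nat -> nat) (gamma : R) (a : nat -> R -> R) (j0 : nat) (h : nat -> nat)
    (hT : 0 < T) (hm : (1 <= m)%N)
    (halpha : forall i, (i < m)%N -> alpha i.+1 < alpha i)
    (halpha_m : 0 <= alpha m)
    (hn : forall i, (i <= m)%N -> (n i)%:R - 1 < alpha i <= (n i)%:R)
    (hgamma : gamma = (n 0%N)%:R - alpha 0%N)
    (hgamma01 : 0 < gamma < 1)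
    (hn01 : n 0%N = n 1%N)
    (ha : forall i, (1 <= i <= m)%N -> Cngamma T 1 gamma (a i))
    (hDa : forall i, (1 <= i <= m)%N ->
      (forall t, 0 < t <= T ->
         RLderivable T ((n 0%N)%:R - alpha 0%N) (a i) t) /\
      Cgamma T 0 (RLderive T ((n 0%N)%:R - alpha 0%N) (a i)))
    (hn0 : (2 <= n 0%N)%N)
    (hj0 : (j0 <= n 0%N - 2)%N)
    (hHj0 : Hset m alpha j0 = set0)
    (hHj0S : Hset m alpha j0.+1 !=set0)
    (hh : forall j, (j0.+1 <= j)%N -> is_min (Hset m alpha j) (h j)) :
  exists y : nat -> R -> R,
    [/\ (forall j, (j < n 0%N)%N -> Cngamma T (n 0%N) gamma (y j)) /\
          canonical_system T m alpha a (n 0%N) y,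
        (forall z : nat -> R -> R,
          (forall j, (j < n 0%N)%N -> Cngamma T (n 0%N) gamma (z j)) ->
          canonical_system T m alpha a (n 0%N) z ->
          forall j, (j < n 0%N)%N -> forall t, 0 <= t <= T -> z j t = y j t),
        (forall j, (j <= j0)%N -> forall t, 0 <= t <= T ->
          y j t = Phi j.+1%:R t)
      & (forall j, (j0.+1 <= j < n 0%N)%N -> forall t, 0 <= t <= T ->
          Phi j.+1%:R t +
            \sum_(0 <= k < N) series_term m alpha a (h j) j k t
            @[N --> \oo] --> y j t)].
Proof.
have [gam0 _] := andP hgamma01.
have alpha_le i k : (i <= k <= m)%N -> alpha k <= alpha i.
  move=> /andP[]; elim: k => [|k IHk]; first by rewrite leqn0 => /eqP->.
  rewrite leq_eqVlt => /predU1P[->//|ik] km.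
  exact: le_trans (ltW (halpha k km)) (IHk ik (ltnW km)).
have alpha_ge0 i : (i <= m)%N -> 0 <= alpha i.
  by move=> im; apply: (le_trans halpha_m); apply: alpha_le; rewrite im leqnn.
have alpha10 : alpha 1%N < alpha 0%N by exact: halpha.
(* This is what emptiness of H_(j0) means, all orders being nonnegative. *)
have alpha_gt i : (1 <= i <= m)%N -> j0%:R < alpha i.
  move=> im; rewrite ltNge; apply/negP => aj.
  have : Hset m alpha j0 i by split=> //; rewrite aj andbT alpha_ge0//; case/andP: im.
  by rewrite hHj0.
have nj i j : (1 <= i <= m)%N -> (j <= j0)%N -> (n i <= j)%N = false.
  move=> im jj; rewrite (n_le_alpha hn); last by case/andP: im.
  by apply/negbTE; rewrite -ltNge; apply: le_lt_trans (alpha_gt i im); rewrite ler_nat.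
(* The orders decrease, so H_j is the whole segment from h_j to m; membership alpha_i <= j is the
   same as n_i <= j. *)
have hP j i : (j0 < j)%N -> i \in index_iota 1 m.+1 -> (h j <= i)%N = (n i <= j)%N.
  rewrite mem_index_iota ltnS => jj im; have /andP[_ im'] := im.
  have [[hm1 /andP[_ hj1]] hj2] := hh j jj; rewrite (n_le_alpha hn)//.
  apply/idP/idP => [hi|ai]; last by apply: hj2; split=> //; rewrite alpha_ge0.
  by apply: le_trans hj1; apply: alpha_le; rewrite hi.
have h_gt0 j : (j0 < j)%N -> (1 <= h j)%N.
  by move=> jj; have [[/andP[]]] := hh j jj.
have a0 i : (1 <= i <= m)%N -> a i 0 = 0.
  move=> im; have [d1 d2] := hDa i im; rewrite -hgamma in d1 d2.
  exact: (RLderivable_at0 hT hgamma01 (ha i im) d1 d2).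
pose r := index_iota 1 m.+1.
have /choice[om hom] : forall j, exists om, [/\ Cgamma T gamma om,
    forall t, 0 < t < T -> RLint gamma om t =
      - \sum_(i <- r) a i t * ((n i <= j)%N%:R * Phi (j.+1%:R - alpha i) t
                               + RLint ((n 0%N)%:R - alpha i) om t),
    (j <= j0)%N -> om = fun=> 0
  & (j0 < j)%N -> forall t, 0 <= t <= T ->
      \sum_(0 <= k < N) series_term m alpha a (h j) j k t @[N --> \oo]
        --> RLint (n 0%N)%:R om t].
  move=> j; have [jj|jj] := leqP j j0.
    (* For j <= j0 every n_i exceeds j, the source is zero and om = 0 solves the equation; y_j is
       then exactly the monomial. *)
    exists (fun=> 0); split=> //; first exact: Cgamma0.
    move=> t _; rewrite RLint0// big1_seq ?oppr0// => i /andP[_].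
    rewrite mem_index_iota ltnS => im; rewrite nj// mul0r add0r RLint0 ?mulr0//.
    rewrite subr_gt0; apply: (@le_lt_trans _ _ (alpha 0%N)).
      by apply: alpha_le; case/andP: im.
    by rewrite -subr_gt0 -hgamma.
  have [om [c1 c2 c3]] := solution_exists hT hgamma01 alpha_le alpha10
    (alpha_ge0 1%N hm) hn hgamma ha a0 j.
  exists om; split=> // _ t tT.
  by apply: (c3 (h j) t tT); [move=> i; exact: hP|exact: h_gt0].
have sol j z o := @solution_taylor R T gamma m alpha n a hT hgamma01 alpha_le alpha10
    hn hgamma j z o.
pose y j t := mono j 0 t + RLint (n 0%N)%:R (om j) t.
have cy j t : 0 <= t <= T -> y j t = mono j 0 t + RLint (n 0%N)%:R (om j) t by [].
have n0gt : (0 : R) < (n 0%N)%:R by rewrite ltr0n (leq_trans _ hn0).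
exists y; split.
- split=> [j jn|j jn]; have [c1 c2 _ _] := hom j.
    exact: (taylor_Cngamma hT hgamma01 jn c1 (cy j)).
  split; first by apply/(sol j (y j) (om j) jn c1 (cy j)).
  by move=> k kn; exact: (taylor_limit hT hgamma01 jn c1 (cy j) kn).
- move=> z cz hz j jn t tT; have [c1 c2 _ _] := hom j; have [hz1 hz2] := hz j jn.
  (* Any competitor has the Taylor form with its own n_0-th derivative as density, so two densities
     can be compared. *)
  have [cz' zE] := taylor_form hT hgamma01 jn (cz j jn) hz2.
  rewrite zE// /y; congr (_ + _).
  apply: (solution_unique hT hgamma01 alpha_le alpha10 (alpha_ge0 1%N hm) hgamma ha
    tT cz' c1 _ c2).
  by apply/(sol j (z j) _ jn cz' zE).
- move=> j jj t tT; have [_ _ o0 _] := hom j; have /andP[t0 _] := tT.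
  by rewrite /y o0// RLint0// addr0 mono_Phi.
- move=> j /andP[jj jn] t tT; have [_ _ _ c4] := hom j; have /andP[t0 _] := tT.
  by rewrite /y mono_Phi//; apply: cvgD; [exact: cvg_cst|exact: c4].
Qed.
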